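(* Let $k\ge 1$, $n\ge 1$ be integers, $\epsilon=(\epsilon_0,\dots,\epsilon_{k-1})\in\mathbb{C}^k$, and $p(\epsilon,x)=x^{k+1}+\epsilon_{k-1}x^{k-1}+\dots+\epsilon_1x+\epsilon_0$. Consider a family of linear systems $p(\epsilon,x)\,y'=B(\epsilon,x)\,y$, $y\in\mathbb{C}^n$, where $B(\epsilon,x)$ is an $n\times n$ matrix of germs of analytic functions of $(\epsilon,x)\in\mathbb{C}^k\times\mathbb{C}$ at the origin such that $B(0,0)$ is diagonal with distinct eigenvalues. Then this family is analytically equivalent to a family in the prenormal form $$p(\epsilon,x)\,y'=\big(\Lambda(\epsilon,x)+p(\epsilon,x)R(\epsilon,x)\big)y,$$ where $\Lambda(\epsilon,x)=\mathrm{diag}\{\lambda_1(\epsilon,x),\dots,\lambda_n(\epsilon,x)\}$ with $$\lambda_i(\epsilon,x)=\lambda_{i,0}(\epsilon)+\lambda_{i,1}(\epsilon)x+\dots+\lambda_{i,k}(\epsilon)x^k,$$ the $\lambda_{i,q}$ are germs of analytic functions of $\epsilon$ at the origin, and $R(\epsilon,x)$ is an $n\times n$ matrix of germs of analytic functions of $(\epsilon,x)$ at the origin.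
   Context: The prime denotes $d/dx$. Two families of systems $y'=A_1(\epsilon,x)y$ and $z'=A_2(\epsilon,x)z$ are (locally) analytically equivalent if there exists an invertible matrix $P(\epsilon,x)$ of germs of analytic functions of $(\epsilon,x)$ at the origin such that the substitution $y=P(\epsilon,x)z$ transforms one system into the other. *)

(* Defs.v *)
From HB Require Import structures.
From mathcomp Require Import all_boot all_order all_algebra.
From mathcomp Require Import all_classical all_reals all_analysis.
From mathcomp.analysis.showcase Require Import summability.
From mathcomp Require Import complex.

Set Implicit Arguments.
Unset Strict Implicit.
Unset Printing Implicit Defensive.

Import Order.TTheory GRing.Theory Num.Theory.
Import numFieldNormedType.Exports.

Local Open Scope classical_set_scope.
Local Open Scope ring_scope.

(* The definitions are stated over an arbitrary [K : numFieldType], because the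
   topology and the derivative of the library are attached to abstract number
   fields and not to the concrete carrier [R[i]]; they are meant to be used at
   [K := complex_field R].

   A germ at the origin is represented by a total function, whose values away
   from some neighbourhood of the origin are irrelevant. *)

Definition complex_field (R : realType) : numFieldType := R[i].

Definition monomial (K : numFieldType) (m : nat) (z : 'rV[K]_m)
    (al : {ffun 'I_m -> nat}) : K :=
  \prod_(i < m) z ord0 i ^+ al i.

(* Near 0, [f] is the sum of a multiple power series.  Convergence along
   [totally] (finite sets of multi-indices directed by inclusion) is
   unconditional, that is, absolute, convergence. *)
Definition analytic_at0 (K : numFieldType) (m : nat) (f : 'rV[K]_m -> K) : Prop :=
  exists a : {ffun 'I_m -> nat} -> K,
    \forall z \near (0 : 'rV[K]_m),
      partial_sum (fun al => a al * monomial z al) @ totally --> f z.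

(* Joint analyticity in (e, x) = (e_0, ..., e_{k-1}, x). *)
Definition analytic2_at0 (K : numFieldType) (k : nat)
    (f : 'rV[K]_k -> K -> K) : Prop :=
  analytic_at0 (fun w : 'rV[K]_(k + 1) =>
    f (lsubmx w) (rsubmx w ord0 ord0)).

Definition analytic_mx (K : numFieldType) (k n : nat)
    (M : 'rV[K]_k -> K -> 'M[K]_n) : Prop :=
  forall i j, analytic2_at0 (fun e x => M e x i j).

(* Invertibility in the ring of n x n matrices of analytic germs. *)
Definition invertible_analytic_mx (K : numFieldType) (k n : nat)
    (P : 'rV[K]_k -> K -> 'M[K]_n) : Prop :=
  analytic_mx P /\
  exists Q : 'rV[K]_k -> K -> 'M[K]_n,
    analytic_mx Q /\
    \forall e \near (0 : 'rV[K]_k) & x \near (0 : K),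
      P e x *m Q e x = 1%:M /\ Q e x *m P e x = 1%:M.

Definition derive_mx (K : numFieldType) (m n : nat)
    (M : K -> 'M[K]_(m, n)) (x : K) : 'M[K]_(m, n) :=
  \matrix_(i, j) derive1 (fun t => M t i j) x.

(* Substituting y = P z, y' = P' z + P z' in  p y' = B1 y  gives
   p P z' = (B1 P - p P') z, which is the system  p z' = B2 z  exactly when
   P B2 = B1 P - p P'; see [substitution_solutions] below. *)
Definition substitution_transforms (K : numFieldType) (k n : nat)
    (p : 'rV[K]_k -> K -> K) (P B1 B2 : 'rV[K]_k -> K -> 'M[K]_n) : Prop :=
  \forall e \near (0 : 'rV[K]_k) & x \near (0 : K),
    P e x *m B2 e x = B1 e x *m P e x - p e x *: derive_mx (P e) x.

(* Analytic equivalence of the families  p y' = B1 y  and  p z' = B2 z. *)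
Definition analytically_equivalent (K : numFieldType) (k n : nat)
    (p : 'rV[K]_k -> K -> K) (B1 B2 : 'rV[K]_k -> K -> 'M[K]_n) : Prop :=
  exists P : 'rV[K]_k -> K -> 'M[K]_n,
    invertible_analytic_mx P /\ substitution_transforms p P B1 B2.

Lemma derive_mx_mul (K : numFieldType) (l m n : nat) (M : K -> 'M[K]_(l, m))
    (N : K -> 'M[K]_(m, n)) (x : K) :
  (forall i j, derivable (fun t => M t i j) x 1) ->
  (forall i j, derivable (fun t => N t i j) x 1) ->
  derive_mx (fun t => M t *m N t) x =
    derive_mx M x *m N x + M x *m derive_mx N x.
Proof.
move=> dM dN; apply/matrixP => i j; rewrite !mxE.
rewrite derive1E.
have -> : (fun t => (M t *m N t) i j) =
    \sum_(h < m) ((fun t => M t i h) * (fun t => N t h j)).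
  by apply/funext => t; rewrite mxE fct_sumE.
rewrite derive_sum; last by move=> h; apply: derivableM.
rewrite -big_split /=; apply: eq_bigr => h _.
rewrite deriveM // !mxE !derive1E addrC; congr (_ + _).
by rewrite /GRing.scale /= mulrC.
Qed.

Lemma substitution_solutions (K : numFieldType) (n : nat) (p : K)
    (P : K -> 'M[K]_n) (B1 B2 : 'M[K]_n) (z : K -> 'cV[K]_n) (x : K) :
  P x \in unitmx ->
  (forall i j, derivable (fun t => P t i j) x 1) ->
  (forall i j, derivable (fun t => z t i j) x 1) ->
  P x *m B2 = B1 *m P x - p *: derive_mx P x ->
  (p *: derive_mx (fun t => P t *m z t) x = B1 *m (P x *m z x) <->
   p *: derive_mx z x = B2 *m z x).
Proof.
move=> uP dP dz gP; rewrite derive_mx_mul // scalerDr scalemxAl scalemxAr.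
have eB : B1 *m (P x *m z x) = (p *: derive_mx P x) *m z x + P x *m (B2 *m z x).
  by rewrite !mulmxA gP mulmxBl addrC subrK.
rewrite eB; split=> [/addrI|->//].
by move/(congr1 (mulmx (invmx (P x)))); rewrite !mulKmx.
Qed.

Definition distinct_eigenvalues (K : numFieldType) (n : nat) (M : 'M[K]_n) : Prop :=
  exists s : seq K, [/\ uniq s, size s = n & all (eigenvalue M) s].

Definition unfolding (K : numFieldType) (k : nat) (e : 'rV[K]_k) (x : K) : K :=
  x ^+ k.+1 + \sum_(i < k) e ord0 i * x ^+ i.

Definition diag_poly_mx (K : numFieldType) (k n : nat)
    (lam : 'I_n -> 'I_k.+1 -> 'rV[K]_k -> K) (e : 'rV[K]_k) (x : K) : 'M[K]_n :=
  diag_mx (\row_(i < n) \sum_(q < k.+1) lam i q e * x ^+ q).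

Definition prenormal_mx (K : numFieldType) (k n : nat)
    (lam : 'I_n -> 'I_k.+1 -> 'rV[K]_k -> K)
    (S : 'rV[K]_k -> K -> 'M[K]_n) (e : 'rV[K]_k) (x : K) : 'M[K]_n :=
  diag_poly_mx lam e x + unfolding e x *: S e x.

(* Main.v *)
Require Import Defs.
From mathcomp Require Import all_boot all_order all_algebra.
From mathcomp Require Import all_classical all_reals all_analysis.
From mathcomp.analysis.showcase Require Import summability.
From mathcomp Require Import complex finmap ring.

(* Since B(0,0) is diagonal with distinct eigenvalues, B is diagonalised by an
   analytic matrix P = 1 + X with X(0) = 0, say B P = P D.  Weierstrass division
   of the entries of D by the monic polynomial p gives D = Lambda + p diag(q),
   and the substitution y = P z turns B into
     P^-1 (B P - p P') = D - p P^-1 P' = Lambda + p (diag(q) - P^-1 P'),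
   which is prenormal.

   The matrices X and P^-1 and the quotients q are found as fixed points of
   maps between formal power series which, for a suitable weight of the
   variables, increase the order and preserve a bound on the l^1 norm
   sum |a_al| |z|^al at a point z of small radius; such a map has a fixed point
   that is a convergent power series. *)

Set Implicit Arguments.
Unset Strict Implicit.
Unset Printing Implicit Defensive.

Import Order.TTheory GRing.Theory Num.Theory.
Import numFieldNormedType.Exports.

Local Open Scope classical_set_scope.
Local Open Scope ring_scope.

#[local] Existing Instance totally_filter.

Local Notation mindex m := {ffun 'I_m -> nat}.

(** * Unconditional sums *)

(** Analyticity is only unconditional convergence near 0, so the work is done on families of
    coefficients. Norms are measured at points with coordinates [r ^+ w i], where a monomial of
    weight d has the value r^d: replacing r by t r, with 0 <= t <= 1, multiplies the norm of a
    series without constant term by at most t, and a single t meets all smallness conditions at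
    once.

    Write B = diag(b) + C with b the diagonal of B(0,0), so that C(0) = 0, and seek X with zero
    diagonal. The diagonal entries of B P = P D then determine D, and a quadratic equation remains
    for the other entries of X, with only the differences b_i - b_j as denominators; this is where
    distinct eigenvalues enter. In that equation every product containing X also contains C, which
    has no constant term, and this raises the order.

    Differentiating P costs half of the radius in x, which is why the substitution is finally
    checked for |x| < r/2. *)

Definition has_sum (K : numFieldType) (I : choiceType) (f : I -> K) (s : K) :=
  partial_sum f @ totally --> s.

(** The bound is put on finite partial sums and not on a limit: it makes sense before any sum is
    known to exist, and it survives passage to a limit whose finite parts are those of
    approximations. *)
Definition abs_le (K : numFieldType) (I : choiceType) (f : I -> K) (C : K) :=
  forall A : {fset I}, \sum_(i <- A) `|f i| <= C.

Section HasSum.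
Variable K : numFieldType.

Lemma partial_sumE (I : choiceType) (f : I -> K) (A : {fset I}) :
  partial_sum f A = \sum_(i <- A) f i.
Proof. by rewrite /partial_sum (big_seq_fsetE _ _ xpredT). Qed.

Lemma has_sumP (I : choiceType) (f : I -> K) (s : K) :
  has_sum f s <-> forall e, 0 < e -> exists A : {fset I},
    forall B : {fset I}, (A `<=` B)%fset -> `|s - \sum_(i <- B) f i| < e.
Proof.
split=> [h e e0|h].
  have /cvgrPdist_lt/(_ e e0) := h.
  by case=> A _ hA; exists A => B AB; rewrite -partial_sumE; apply: hA.
apply/cvgrPdist_lt => e e0; have [A hA] := h e e0.
by exists A => // B AB; rewrite /= partial_sumE; apply: hA.
Qed.

Lemma has_sum_unique (I : choiceType) (f : I -> K) (s t : K) :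
  has_sum f s -> has_sum f t -> s = t.
Proof. exact: cvg_unique. Qed.

Lemma eq_has_sum (I : choiceType) (f g : I -> K) (s : K) :
  f =1 g -> has_sum f s -> has_sum g s.
Proof. by move=> /funext ->. Qed.

Lemma has_sumD (I : choiceType) (f g : I -> K) (s t : K) :
  has_sum f s -> has_sum g t -> has_sum (fun i => f i + g i) (s + t).
Proof.
move=> hf hg; rewrite /has_sum.
have -> : partial_sum (fun i => f i + g i) = partial_sum f \+ partial_sum g.
  by apply/funext => A; rewrite /= !partial_sumE big_split.
exact: cvgD.
Qed.

Lemma has_sumZ (I : choiceType) (f : I -> K) (s c : K) :
  has_sum f s -> has_sum (fun i => c * f i) (c * s).
Proof.
move=> hf; rewrite /has_sum.
have -> : partial_sum (fun i => c * f i) = (fun A => c * partial_sum f A).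
  by apply/funext => A; rewrite /= !partial_sumE big_distrr.
exact: cvgMl_tmp.
Qed.

Lemma has_sum_sum (I : choiceType) (T : Type) (r : seq T) (P : pred T)
    (f : T -> I -> K) (s : T -> K) :
  (forall t, P t -> has_sum (f t) (s t)) ->
  has_sum (fun i => \sum_(t <- r | P t) f t i) (\sum_(t <- r | P t) s t).
Proof.
move=> h; elim: r => [|t r IH].
  rewrite big_nil; under eq_fun do rewrite big_nil.
  rewrite /has_sum.
  have -> : partial_sum (fun=> 0 : K) = cst (0 : K) :> ({fset I} -> K).
    by apply/funext => A; rewrite partial_sumE big1.
  exact: cvg_cst.
rewrite big_cons; under eq_fun do rewrite big_cons.
by case: ifP => // Pt; apply: has_sumD => //; apply: h.
Qed.

Lemma has_sum_le (I : choiceType) (f : I -> K) (s C : K) :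
  0 <= C -> (forall A : {fset I}, `|\sum_(i <- A) f i| <= C) ->
  has_sum f s -> `|s| <= C.
Proof.
move=> C0 hC /has_sumP hs.
have h e : 0 < e -> `|s| < C + e.
  move=> e0; have [A /(_ A (fsubset_refl _)) hA] := hs e e0.
  rewrite -[s](subrK (\sum_(i <- A) f i)) (le_lt_trans (ler_normD _ _)) //.
  by rewrite addrC ler_ltD.
have sr : `|s| \is Num.real by rewrite ger0_real.
have Cr : C \is Num.real by rewrite ger0_real.
have [//|lt] := real_leP sr Cr.
by have := h (`|s| - C); rewrite subr_gt0 addrC subrK ltxx => /(_ lt).
Qed.

Lemma abs_leW (I : choiceType) (f : I -> K) (C D : K) :
  C <= D -> abs_le f C -> abs_le f D.
Proof. by move=> CD hf A; apply: le_trans CD. Qed.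

Lemma abs_le_ge0 (I : choiceType) (f : I -> K) (C : K) : abs_le f C -> 0 <= C.
Proof. by move=> /(_ fset0); rewrite big_seq_fset0. Qed.

Lemma abs_leD (I : choiceType) (f g : I -> K) (C D : K) :
  abs_le f C -> abs_le g D -> abs_le (fun i => f i + g i) (C + D).
Proof.
move=> hf hg A; apply: le_trans (lerD (hf A) (hg A)).
by rewrite -big_split ler_sum //= => i _; exact: ler_normD.
Qed.

Lemma abs_leZ (I : choiceType) (f : I -> K) (c C : K) :
  abs_le f C -> abs_le (fun i => c * f i) (`|c| * C).
Proof.
move=> hf A; under eq_bigr do rewrite normrM.
by rewrite -mulr_sumr ler_wpM2l.
Qed.

Lemma abs_le0 (I : choiceType) : abs_le (fun _ : I => 0 : K) 0.
Proof. by move=> A; rewrite big1 // => i _; rewrite normr0. Qed.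

Lemma abs_le_sum (I : choiceType) (T : Type) (r : seq T) (P : pred T)
    (f : T -> I -> K) (C : T -> K) :
  (forall t, P t -> abs_le (f t) (C t)) ->
  abs_le (fun i => \sum_(t <- r | P t) f t i) (\sum_(t <- r | P t) C t).
Proof.
move=> h; elim: r => [|t r IH].
  by rewrite big_nil; under eq_fun do rewrite big_nil; exact: abs_le0.
rewrite big_cons; under eq_fun do rewrite big_cons.
by case: ifP => // Pt; apply: abs_leD => //; apply: h.
Qed.

Lemma abs_le_ler (I : choiceType) (f g : I -> K) (C : K) :
  (forall i, `|f i| <= `|g i|) -> abs_le g C -> abs_le f C.
Proof. by move=> fg hg A; apply: le_trans (hg A); exact: ler_sum. Qed.

Lemma abs_le_inj (I J : choiceType) (h : J -> I) (f : I -> K) (C : K) :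
  injective h -> abs_le f C -> abs_le (fun j => f (h j)) C.
Proof.
move=> hinj hf A; apply: le_trans (hf (h @` A)%fset).
by rewrite big_imfset //= => x y _ _; exact: hinj.
Qed.

Section Push.
Variables (I J : choiceType) (h : J -> I) (fib : I -> {fset J}).
Hypothesis fibP : forall i j, (j \in fib i) = (h j == i).

(** Elements of [B] with empty fibre contribute nothing; the other fibres partition the union. *)
Lemma sum_fib (V : nmodType) (f : J -> V) (B : {fset I}) :
  \sum_(i <- B) \sum_(j <- fib i) f j =
  \sum_(j <- (\bigcup_(i <- B) fib i)%fset) f j.
Proof.
have hB : (h @` (\bigcup_(i <- B) fib i)%fset `<=` B)%fset.
  apply/fsubsetP => i /imfsetP[j /= /bigfcupP[i' /andP[i'B _]]].
  by rewrite fibP => /eqP hj ->; rewrite hj.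
rewrite (partition_big_imfset _ h) /=.
rewrite (big_fset_incl _ hB) /= => [|i iB inB].
  rewrite [LHS]big_seq_cond [RHS]big_seq_cond; apply: eq_bigr => i /andP[iB _].
  rewrite [RHS]big_fset_condE/=; apply: eq_fbigl => j.
  rewrite !inE /= fibP; case: eqP => [hj|]; last by rewrite andbF.
  rewrite andbT; apply/esym/bigfcupP; exists i; first by rewrite iB.
  by rewrite fibP hj.
rewrite big_seq_cond big1 // => j /andP[_ /eqP hj]; move: inB.
have /bigfcupP : exists2 i0, (i0 \in B) && true & j \in fib i0.
  by exists i; rewrite ?iB ?fibP ?hj.
by move=> jB; rewrite -hj in_imfset.
Qed.

Lemma has_sum_push (f : J -> K) (s : K) :
  has_sum f s -> has_sum (fun i => \sum_(j <- fib i) f j) s.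
Proof.
move=> /has_sumP hf; apply/has_sumP => e e0; have [A hA] := hf e e0.
exists (h @` A)%fset => B AB; rewrite sum_fib; apply: hA.
apply/fsubsetP => j jA; apply/bigfcupP; exists (h j); last by rewrite fibP.
by rewrite andbT (fsubsetP AB) // in_imfset.
Qed.

Lemma abs_le_push (f : J -> K) (C : K) :
  abs_le f C -> abs_le (fun i => \sum_(j <- fib i) f j) C.
Proof.
move=> hf B; apply: le_trans (hf (\bigcup_(i <- B) fib i)%fset).
rewrite -sum_fib; apply: ler_sum => i _; exact: ler_norm_sum.
Qed.

End Push.

Lemma inj_fib (I J : choiceType) (h : J -> I) : injective h ->
  exists fib : I -> {fset J}, forall i j, (j \in fib i) = (h j == i).
Proof.
move=> hinj.
have ex i : exists A : {fset J}, forall j, (j \in A) = (h j == i).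
  have [[j hj]|no] := pselect (exists j, h j = i).
    exists [fset j]%fset => j'; rewrite inE -hj.
    by apply/idP/idP => [/eqP ->//|/eqP/hinj ->//].
  by exists fset0 => j; rewrite inE; apply/esym/eqP => hj; apply: no; exists j.
by exists (fun i => sval (cid (ex i))) => i; exact: (svalP (cid (ex i))).
Qed.

Lemma push_inj (I J : choiceType) (h : J -> I) (fib : I -> {fset J})
    (f : I -> K) : injective h ->
  (forall i j, (j \in fib i) = (h j == i)) ->
  (forall i, f i != 0 -> exists j, h j = i) ->
  (fun i => \sum_(j <- fib i) f (h j)) = f.
Proof.
move=> hinj fibP hf; apply/funext => i.
have [[j hj]|no] := pselect (exists j, h j = i).
  have -> : fib i = [fset j]%fset.
    apply/fsetP => j'; rewrite inE fibP -hj.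
    by apply/idP/idP => [/eqP/hinj ->//|/eqP ->//].
  by rewrite big_seq_fset1 hj.
have -> : f i = 0 by apply/eqP; apply/negP => /negP/hf.
by rewrite big_seq big1 // => j; rewrite fibP => /eqP hj; case: no; exists j.
Qed.

Lemma has_sum_inj (I J : choiceType) (h : J -> I) (f : I -> K) (s : K) :
  injective h -> (forall i, f i != 0 -> exists j, h j = i) ->
  has_sum (fun j => f (h j)) s -> has_sum f s.
Proof.
move=> hinj hf hs; have [fib fibP] := inj_fib hinj.
by rewrite -(push_inj hinj fibP hf); exact: has_sum_push.
Qed.

Lemma has_sum_single (I : choiceType) (f : I -> K) (i0 : I) :
  (forall i, i != i0 -> f i = 0) -> has_sum f (f i0).
Proof.
move=> h; apply/has_sumP => e e0; exists [fset i0]%fset => B; rewrite fsub1set => iB.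
rewrite (big_fsetD1 i0) //= big_seq big1 ?addr0 ?subrr ?normr0 // => i.
by rewrite !inE => /andP[/h].
Qed.

Lemma abs_le_single (I : choiceType) (f : I -> K) (i0 : I) :
  (forall i, i != i0 -> f i = 0) -> abs_le f `|f i0|.
Proof.
move=> h B; have [iB|iB] := boolP (i0 \in B).
  rewrite (big_fsetD1 i0) //= big_seq big1 ?addr0 // => i.
  by rewrite !inE => /andP[/h ->]; rewrite normr0.
rewrite big_seq big1 // => i ib; rewrite h ?normr0 //.
by apply: contraNneq iB => <-.
Qed.

Lemma ler_sum_fset (I : choiceType) (f : I -> K) (A B : {fset I}) :
  (A `<=` B)%fset -> (forall i, 0 <= f i) ->
  \sum_(i <- A) f i <= \sum_(i <- B) f i.
Proof.
move=> AB f0; rewrite [leRHS](big_fsetID _ (mem A)) /=.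
rewrite [X in _ <= X + _](_ : _ = \sum_(i <- A) f i); last first.
  apply: eq_fbigl => i; rewrite !inE /= andbC.
  by case: (boolP (i \in A)) => // /(fsubsetP AB) ->.
by rewrite lerDl sumr_ge0.
Qed.

Lemma sum_fsetX (I J : choiceType) (f : I -> K) (g : J -> K)
    (A : {fset I}) (B : {fset J}) :
  \sum_(p <- (A `*` B)%fset) f p.1 * g p.2 = (\sum_(i <- A) f i) * (\sum_(j <- B) g j).
Proof.
rewrite big_distrlr /= pair_big_dep_cond /=.
apply: eq_fbigl => -[i j]; rewrite !inE /=.
by rewrite !andbT.
Qed.

Lemma abs_leM (I J : choiceType) (f : I -> K) (g : J -> K) (C D : K) :
  abs_le f C -> abs_le g D ->
  abs_le (fun p : I * J => f p.1 * g p.2) (C * D).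
Proof.
move=> hf hg A.
have sub : (A `<=` (fst @` A) `*` (snd @` A))%fset.
  by apply/fsubsetP => p pA; rewrite !inE !in_imfset.
apply: le_trans (ler_sum_fset sub _) _ => [p|]; first exact: normr_ge0.
under eq_bigr do rewrite normrM.
by rewrite (sum_fsetX (fun i => `|f i|) (fun j => `|g j|)) ler_pM // sumr_ge0.
Qed.

(** Only the value of the product is identified here. That the double family has a sum at all needs
    completeness and comes from [has_sum_exists] below. *)
Lemma has_sumM_unique (I J : choiceType) (f : I -> K) (g : J -> K) (s t u : K) :
  has_sum f s -> has_sum g t ->
  has_sum (fun p : I * J => f p.1 * g p.2) u -> u = s * t.
Proof.
move=> hs ht hu.
pose X (AB : {fset I} * {fset J}) := (AB.1 `*` AB.2)%fset.
(* Finite rectangles are cofinal among the finite subsets of [I * J], so the sum can be computed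
   along them, where it factors. *)
have XF : X @ filter_prod totally totally --> totally.
  move=> P [A _ hA].
  exists ([set B | ((fst @` A) `<=` B)%fset], [set B | ((snd @` A) `<=` B)%fset]).
    by split; [exists (fst @` A)%fset|exists (snd @` A)%fset].
  move=> [B1 B2] /= [h1 h2]; apply: hA; apply/fsubsetP => p pA.
  by rewrite inE (fsubsetP h1) ?(fsubsetP h2) // in_imfset.
pose F AB := partial_sum (fun p : I * J => f p.1 * g p.2) (X AB).
have h1 : F @ filter_prod totally totally --> u by exact: (cvg_comp _ _ XF hu).
have h2 : F @ filter_prod totally totally --> s * t.
  have -> : F = (fun AB => partial_sum f AB.1 * partial_sum g AB.2).
    by apply/funext => AB; rewrite /F !partial_sumE (sum_fsetX f g).
  apply: cvgM.
    have := cvg_comp _ _ (@cvg_fst _ _ (@totally I) (@totally J) _) hs.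
    exact.
  have := cvg_comp _ _ (@cvg_snd _ _ (@totally I) (@totally J) _) ht.
  exact.
exact: cvg_unique h1 h2.
Qed.

End HasSum.
Arguments has_sumZ {K I f s} c.
Arguments abs_leZ {K I f} c {C}.

(** * Existence of sums over the complex numbers *)

Section ComplexSums.
Variable R : realType.
Local Notation K := (complex_field R).

Lemma has_sum_ge0 (I : choiceType) (f : I -> K) (C : K) :
  (forall i, 0 <= f i) -> abs_le f C -> exists s, has_sum f s.
Proof.
move=> f0 hf; pose S (A : {fset I}) : K := \sum_(i <- A) f i.
have S0 A : 0 <= S A by exact: sumr_ge0.
have SC A : S A <= C.
  by have := hf A; under eq_bigr do rewrite ger0_norm //.
have ReS A : S A = (complex.Re (S A))%:C%C :> R[i].
  by rewrite RRe_real // ger0_real // S0.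
(* Suprema live in [R]. Nonnegative elements of [R[i]] are real, so nothing is lost by passing to
   real parts. *)
pose E : set R := [set complex.Re (S A) | A in setT].
have E0 : E !=set0 by exists (complex.Re (S fset0)); exists fset0.
have ubE : ubound E (complex.Re (C : R[i])).
  by move=> _ [A _ <-]; have := SC A; rewrite lecE => /andP[].
have hE : has_sup E by split => //; exists (complex.Re (C : R[i])).
exists ((sup E)%:C%C : R[i]); apply/has_sumP => e e0.
have ee : e = (complex.Re (e : R[i]))%:C%C :> R[i] by rewrite RRe_real // gtr0_real.
have re0 : 0 < complex.Re (e : R[i]) by move: e0; rewrite ltcE => /andP[].
have [_ [A _ <-] hA] := sup_adherent re0 hE.
exists A => B AB; rewrite -/(S B).
have SAB : complex.Re (S A) <= complex.Re (S B).
  by have := ler_sum_fset AB f0; rewrite -/(S A) -/(S B) lecE => /andP[].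
have SBs : complex.Re (S B) <= sup E.
  by apply: ub_le_sup; [exists (complex.Re (C : R[i]))|exists B].
rewrite (ReS B) -rmorphB /= ger0_norm; last by rewrite ler0c subr_ge0.
rewrite ee ltcR ltrBlDr -ltrBlDl; apply: lt_le_trans SAB.
exact: hA.
Qed.

(** Writes f = |f| - (|f| - f), a difference of two nonnegative families. *)
Lemma has_sum_real (I : choiceType) (f : I -> K) (C : K) :
  (forall i, f i \is Num.real) -> abs_le f C -> exists s, has_sum f s.
Proof.
move=> fr hf.
have h0 i : 0 <= `|f i| - f i by rewrite subr_ge0 real_ler_norm.
have [s hs] : exists s, has_sum (fun i => `|f i|) s.
  by apply: (@has_sum_ge0 _ _ C) => // A; under eq_bigr do rewrite normr_id.
have [t ht] : exists s, has_sum (fun i => `|f i| + -1 * f i) s.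
  apply: (@has_sum_ge0 _ _ (C + `|-1| * C)) => [i|].
    by rewrite mulN1r.
  by apply: abs_leD; [move=> A; under eq_bigr do rewrite normr_id|exact: abs_leZ].
exists (s + -1 * t); have := has_sumD hs (has_sumZ (-1) ht); apply: eq_has_sum => i.
by rewrite !mulN1r opprB addrC subrK.
Qed.

(** Both f + conj f and i (conj f - f) are real, and f is half of the first plus i times the
    second. *)
Lemma has_sum_exists (I : choiceType) (f : I -> K) (C : K) :
  abs_le f C -> exists s, has_sum f s.
Proof.
move=> hf; pose fc i : K := ((f i : R[i])^*)%R.
pose j : K := ('i : R[i])%R; have jj : j * j = -1 by exact: (sqrCi R[i]).
have nc i : `|fc i| = `|f i| by exact: (norm_conjC (f i : R[i])).
have hfc : abs_le fc C by apply: abs_le_ler hf => i; rewrite nc.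
have [s hs] : exists s, has_sum (fun i => f i + fc i) s.
  apply: (@has_sum_real _ _ (C + C)) => [i|]; last exact: abs_leD.
  have -> : f i + fc i = (2 * 'Re (f i : R[i]))%R :> R[i].
    by rewrite ReE mulrC divfK // pnatr_eq0.
  by rewrite realM // ?realn // Creal_Re.
have [t ht] : exists s, has_sum (fun i => j * (fc i + -1 * f i)) s.
  apply: (@has_sum_real _ _ (`|j| * (C + `|-1| * C))) => [i|]; last first.
    by apply: abs_leZ; apply: abs_leD => //; exact: abs_leZ.
  have -> : j * (fc i + -1 * f i) = (2 * 'Im (f i : R[i]))%R :> R[i].
    by rewrite ImE mulN1r mulrC [RHS]mulrC divfK // pnatr_eq0.
  by rewrite realM // ?realn // Creal_Im.
exists (2^-1 * (s + j * t)).
have := has_sumZ (2^-1) (has_sumD hs (has_sumZ j ht)); apply: eq_has_sum => i.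
have -> : j * (j * (fc i + -1 * f i)) = f i - fc i.
  by rewrite mulrA jj !mulN1r opprD opprK addrC.
by rewrite addrACA subrr addr0 -mulr2n -[f i *+ 2]mulr_natl mulKf // pnatr_eq0.
Qed.

Lemma has_sumM (I J : choiceType) (f : I -> K) (g : J -> K) (C D s t : K) :
  abs_le f C -> abs_le g D -> has_sum f s -> has_sum g t ->
  has_sum (fun p : I * J => f p.1 * g p.2) (s * t).
Proof.
move=> hf hg hs ht; have [u hu] := has_sum_exists (abs_leM hf hg).
by rewrite -(has_sumM_unique hs ht hu).
Qed.

End ComplexSums.

(** * Multi-indices and formal power series *)

Section MultiIndex.
Variable m : nat.
Implicit Types (al be : mindex m) (p : mindex m * mindex m).

Definition madd al be : mindex m := [ffun i => al i + be i]%N.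
Definition mzero : mindex m := [ffun=> 0%N].

Lemma maddIr al : injective (madd al).
Proof.
move=> b c /ffunP h; apply/ffunP => i; have := h i.
by rewrite !ffunE => /addnI.
Qed.

Lemma madd_eq0 al be : (madd al be == mzero) = (al == mzero) && (be == mzero).
Proof.
apply/eqP/andP => [/ffunP h|[/eqP -> /eqP ->]]; last first.
  by apply/ffunP => i; rewrite !ffunE.
by split; apply/eqP/ffunP => i; have := h i; rewrite !ffunE => /eqP;
  rewrite addn_eq0 => /andP[/eqP ? /eqP ?].
Qed.

(** All entries of a decomposition of [al] are at most |al|, so the decompositions lie in the finite
    set of pairs of functions into ['I_N]. *)
Lemma splits_ex al : exists A : {fset mindex m * mindex m},
  forall p, (p \in A) = (madd p.1 p.2 == al).
Proof.
pose N := (\sum_i al i).+1.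
pose tr (g : {ffun 'I_m -> 'I_N}) : mindex m := [ffun i => val (g i)].
pose A := [fset ((tr g.1, tr g.2) : mindex m * mindex m) |
  g in ({: {ffun 'I_m -> 'I_N} * {ffun 'I_m -> 'I_N}})]%fset.
exists [fset p in A | madd p.1 p.2 == al]%fset => p; rewrite !inE /=.
have [pal|] := eqVneq (madd p.1 p.2) al; rewrite ?andbF ?andbT //.
have le i : (p.1 i + p.2 i < N)%N.
  move/ffunP/(_ i): pal; rewrite ffunE => ->.
  by rewrite ltnS (bigD1 i) //= leq_addr.
have le1 i : (p.1 i < N)%N by apply: leq_ltn_trans (le i); exact: leq_addr.
have le2 i : (p.2 i < N)%N by apply: leq_ltn_trans (le i); exact: leq_addl.
apply/imfsetP; exists ([ffun i => Ordinal (le1 i)], [ffun i => Ordinal (le2 i)]) => //=.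
by rewrite [LHS]surjective_pairing; congr pair; apply/ffunP => i; rewrite !ffunE.
Qed.

Definition splits al : {fset mindex m * mindex m} := sval (cid (splits_ex al)).

Lemma splitsP al p : (p \in splits al) = (madd p.1 p.2 == al).
Proof. exact: (svalP (cid (splits_ex al))). Qed.

Variable w : 'I_m -> nat.

Definition weight al := (\sum_i w i * al i)%N.

Lemma weightD al be : weight (madd al be) = (weight al + weight be)%N.
Proof.
by rewrite /weight -big_split; apply: eq_bigr => i _; rewrite ffunE mulnDr.
Qed.

Lemma weight_gt0 al : (forall i, 0 < w i)%N -> al != mzero -> (0 < weight al)%N.
Proof.
move=> w0; apply: contraNT; rewrite -eqn0Ngt sum_nat_eq0 => /forallP h.
apply/eqP/ffunP => i; have := h i; rewrite implyTb muln_eq0 ffunE.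
by have := w0 i; case: (w i) => // n _ /= /eqP.
Qed.

End MultiIndex.
Arguments mzero {m}.

Section Monomial.
Variables (K : numFieldType) (m : nat).
Implicit Types (al be : mindex m) (z : 'rV[K]_m).

Lemma monomialD z al be : monomial z (madd al be) = monomial z al * monomial z be.
Proof.
by rewrite /monomial -big_split; apply: eq_bigr => i _; rewrite ffunE exprD.
Qed.

Lemma monomial_zero z : monomial z mzero = 1.
Proof. by rewrite /monomial big1 // => i _; rewrite ffunE expr0. Qed.

Lemma monomial_at0 al : al != mzero -> monomial (0 : 'rV[K]_m) al = 0.
Proof.
move=> al0; have [i ai] : exists i, al i != 0%N.
  apply/existsP; apply: contraNT al0; rewrite negb_exists => /forallP h.
  by apply/eqP/ffunP => i; have := h i; rewrite negbK ffunE => /eqP.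
by rewrite /monomial (bigD1 i) //= mxE expr0n (negbTE ai) mul0r.
Qed.

Lemma ler_norm_monomial z z' al :
  (forall i, `|z ord0 i| <= `|z' ord0 i|) -> `|monomial z al| <= `|monomial z' al|.
Proof.
move=> h; rewrite /monomial !normr_prod; apply: ler_prod => i _.
by rewrite normr_ge0 /= !normrX lerXn2r ?nnegrE.
Qed.

(** Weighted point at which norms are measured: a monomial there depends on its weight alone. *)
Definition radius (w : 'I_m -> nat) (r : K) : 'rV[K]_m := \row_i r ^+ w i.

Lemma monomial_radius w r al : monomial (radius w r) al = r ^+ weight w al.
Proof.
rewrite /monomial /weight expr_sum; apply: eq_bigr => i _.
by rewrite mxE exprM.
Qed.

End Monomial.

(** * Formal power series: products, norms, fixed points *)

Section Series.
Variables (K : numFieldType) (m : nat).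
Local Notation series := (mindex m -> K).
Implicit Types (a b : series) (z : 'rV[K]_m).

Definition terms a z : series := fun al => a al * monomial z al.

Definition smul a b : series := fun al => \sum_(p <- splits al) a p.1 * b p.2.

Definition smono (be : mindex m) : series := fun al => (al == be)%:R.

Lemma terms_smul a b z :
  terms (smul a b) z = (fun al => \sum_(p <- splits al) terms a z p.1 * terms b z p.2).
Proof.
apply/funext => al; rewrite /terms /smul big_distrl /=.
rewrite big_seq [RHS]big_seq; apply: eq_bigr => p.
by rewrite splitsP => /eqP <-; rewrite monomialD mulrACA.
Qed.

Lemma abs_le_smul a b z C D : abs_le (terms a z) C -> abs_le (terms b z) D ->
  abs_le (terms (smul a b) z) (C * D).
Proof.
move=> ha hb; rewrite terms_smul.
exact: (abs_le_push (fun al p => splitsP al p) (abs_leM ha hb)).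
Qed.

Lemma abs_le_termsD a b z C D : abs_le (terms a z) C -> abs_le (terms b z) D ->
  abs_le (terms (fun al => a al + b al) z) (C + D).
Proof.
move=> ha hb; rewrite (_ : terms _ z = (fun al => terms a z al + terms b z al)).
  exact: abs_leD.
by apply/funext => al; rewrite /terms mulrDl.
Qed.

Lemma abs_le_termsZ c a z C : abs_le (terms a z) C ->
  abs_le (terms (fun al => c * a al) z) (`|c| * C).
Proof.
move=> ha; rewrite (_ : terms _ z = (fun al => c * terms a z al)).
  exact: abs_leZ.
by apply/funext => al; rewrite /terms mulrA.
Qed.

Lemma abs_le_termsN a z C : abs_le (terms a z) C ->
  abs_le (terms (fun al => - a al) z) C.
Proof. by apply: abs_le_ler => al; rewrite /terms mulNr normrN. Qed.

Lemma abs_le_terms_sum (T : finType) (a : T -> series) z (C : T -> K) :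
  (forall t, abs_le (terms (a t) z) (C t)) ->
  abs_le (terms (fun al => \sum_t a t al) z) (\sum_t C t).
Proof.
move=> ha; rewrite (_ : terms _ z = (fun al => \sum_t terms (a t) z al)).
  exact: abs_le_sum.
by apply/funext => al; rewrite /terms mulr_suml.
Qed.

Lemma abs_le_terms_disc a z z' C : (forall i, `|z ord0 i| <= `|z' ord0 i|) ->
  abs_le (terms a z') C -> abs_le (terms a z) C.
Proof.
move=> h; apply: abs_le_ler => al; rewrite /terms !normrM ler_wpM2l //.
exact: ler_norm_monomial.
Qed.

Lemma abs_le_smono be z : abs_le (terms (smono be) z) `|monomial z be|.
Proof.
have := @abs_le_single K _ (terms (smono be) z) be.
rewrite /terms /smono eqxx mul1r; apply => al /negbTE ->.
by rewrite mul0r.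
Qed.

Lemma has_sum_smono be z : has_sum (terms (smono be) z) (monomial z be).
Proof.
have := @has_sum_single K _ (terms (smono be) z) be.
rewrite /terms /smono eqxx mul1r; apply => al /negbTE ->.
by rewrite mul0r.
Qed.

Lemma has_sum_termsD a b z s t : has_sum (terms a z) s -> has_sum (terms b z) t ->
  has_sum (terms (fun al => a al + b al) z) (s + t).
Proof.
by move=> ha hb; apply: eq_has_sum (has_sumD ha hb) => al; rewrite /terms mulrDl.
Qed.

Lemma has_sum_termsZ c a z s : has_sum (terms a z) s ->
  has_sum (terms (fun al => c * a al) z) (c * s).
Proof.
by move=> ha; apply: eq_has_sum (has_sumZ c ha) => al; rewrite /terms mulrA.
Qed.

Lemma has_sum_termsN a z s : has_sum (terms a z) s ->
  has_sum (terms (fun al => - a al) z) (- s).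
Proof.
move=> ha; rewrite -mulN1r; apply: eq_has_sum (has_sumZ (-1) ha) => al.
by rewrite /terms mulN1r mulNr.
Qed.

Lemma has_sum_terms_sum (T : finType) (a : T -> series) z (s : T -> K) :
  (forall t, has_sum (terms (a t) z) (s t)) ->
  has_sum (terms (fun al => \sum_t a t al) z) (\sum_t s t).
Proof.
move=> ha; have := @has_sum_sum K _ _ (index_enum T) xpredT _ _ (fun t _ => ha t).
by apply: eq_has_sum => al; rewrite /terms mulr_suml.
Qed.

Lemma has_sum_at0 a s : has_sum (terms a 0) s -> s = a mzero.
Proof.
move=> hs; apply: (has_sum_unique hs).
have := @has_sum_single K _ (terms a 0) mzero.
rewrite [terms a 0 mzero]/terms monomial_zero mulr1; apply => al al0.
by rewrite /terms monomial_at0 // mulr0.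
Qed.

Section Agree.
Variable w : 'I_m -> nat.

Definition agree (d : nat) a b := forall al, (weight w al < d)%N -> a al = b al.

(** A factor of order at least [s] gains [s] weights of agreement. *)
Lemma agree_smulr d s a b b' : (forall al, (weight w al < s)%N -> a al = 0) ->
  agree d b b' -> agree (d + s) (smul a b) (smul a b').
Proof.
move=> a0 bb al lt; rewrite /smul big_seq [RHS]big_seq; apply: eq_bigr => p.
rewrite splitsP => /eqP pal; have [lt1|le1] := ltnP (weight w p.1) s.
  by rewrite a0 // !mul0r.
rewrite bb // -(ltn_add2r s) (leq_ltn_trans _ lt) // -pal weightD addnC.
by rewrite leq_add2r.
Qed.

(** As the second factors have no constant term, a contributing index has a second part of positive
    weight; this leaves weight less than [d] for the first part, so [a] and [a'] may agree one step
    less. *)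
Lemma agree_smul d a a' b b' : (forall i, 0 < w i)%N ->
  b mzero = 0 -> b' mzero = 0 -> agree d a a' -> agree d.+1 b b' ->
  agree d.+1 (smul a b) (smul a' b').
Proof.
move=> w0 b0 b'0 aa bb al lt; rewrite /smul big_seq [RHS]big_seq; apply: eq_bigr => p.
rewrite splitsP => /eqP pal; move: lt; rewrite -pal weightD ltnS => le.
have [->|p20] := eqVneq p.2 mzero; first by rewrite b0 b'0 !mulr0.
have p2 := weight_gt0 w0 p20.
rewrite bb ?ltnS ?(leq_trans _ le) ?leq_addl //.
rewrite aa // (leq_trans _ le) // -[X in (X < _)%N]addn0 ltn_add2l //.
Qed.

Lemma smul_zero a b : a mzero = 0 -> smul a b mzero = 0.
Proof.
move=> a0; rewrite /smul big_seq big1 // => p.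
by rewrite splitsP madd_eq0 => /andP[/eqP -> _]; rewrite a0 mul0r.
Qed.

(* The iterates of [G] at 0 are stationary in each weight, and any finite part
   of their limit is a finite part of some iterate, so that norm bounds pass to
   the limit without any completeness argument. *)
Lemma series_fixpoint (J : Type) (G : (J -> series) -> J -> series) z (C : K) :
  0 <= C ->
  (forall d X Y, (forall j, agree d (X j) (Y j)) ->
     forall j, agree d.+1 (G X j) (G Y j)) ->
  (forall X, (forall j, abs_le (terms (X j) z) C) ->
     forall j, abs_le (terms (G X j) z) C) ->
  exists X, (forall j, X j =1 G X j) /\ forall j, abs_le (terms (X j) z) C.
Proof.
move=> C0 Gagree Gbound.
pose X n := iter n G (fun _ _ => 0).
have XC n j : abs_le (terms (X n j) z) C.
  elim: n j => [j|n IH]; last exact: Gbound.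
  apply: (abs_leW C0); apply: abs_le_ler (@abs_le0 _ _) => al.
  by rewrite /terms /= mul0r.
have XS n j : agree n (X n j) (X n.+1 j).
  by elim: n j => [j al //|n IH j]; apply: Gagree.
have XD n p j : agree n (X n j) (X (n + p)%N j).
  elim: p => [|p IH] al lt; first by rewrite addn0.
  by rewrite IH // addnS XS // (leq_trans lt) // leq_addr.
pose L j al := X (weight w al).+1 j al.
have LX n j : agree n (L j) (X n j).
  by move=> al lt; rewrite /L (XD _ (n - (weight w al).+1)%N j al) // subnKC.
exists L; split=> [j al|j A].
  rewrite (LX (weight w al).+1 j al) //.
  rewrite -[RHS](Gagree (weight w al) (X (weight w al)) L) // => i be lt.
  by rewrite (LX _ _ _ lt).
pose N := (\sum_(al <- A) weight w al).+1.
rewrite (_ : \sum_(i <- A) _ = \sum_(i <- A) `|terms (X N j) z i|); first exact: XC.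
rewrite big_seq [RHS]big_seq; apply: eq_bigr => al alA.
rewrite /terms (LX N j) // ltnS (big_fsetD1 al) //=; exact: leq_addr.
Qed.

End Agree.

Section Radius.
Variable w : 'I_m -> nat.
Hypothesis w_gt0 : forall i, (0 < w i)%N.

(** Every surviving index has weight at least 1, and t^weight <= t. *)
Lemma abs_le_vanish a (r t C : K) : 0 <= r -> 0 <= t -> t <= 1 ->
  a mzero = 0 -> abs_le (terms a (radius w r)) C ->
  abs_le (terms a (radius w (t * r))) (t * C).
Proof.
move=> r0 t0 t1 a0 ha; rewrite -[in t * C](ger0_norm t0).
apply: abs_le_ler (abs_leZ t ha) => al; rewrite /terms !monomial_radius.
have [->|al0] := eqVneq al mzero; first by rewrite a0 !mul0r mulr0.
rewrite exprMn mulrCA [leLHS]normrM [leRHS]normrM ler_wpM2r //.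
rewrite !ger0_norm // ?exprn_ge0 //.
have := weight_gt0 w_gt0 al0; case: (weight w al) => // n _.
by rewrite exprS ler_piMr // exprn_ile1.
Qed.

(** A finite set of multi-indices lies in a box, over which the sum factors into [m] geometric sums,
    each at most 2. *)
Lemma geometric_bound :
  abs_le (fun al : mindex m => (2^-1 : K) ^+ (\sum_i al i)) (2 ^+ m).
Proof.
move=> A; pose N := (\sum_(al <- A) \sum_i al i).+1.
pose tr (g : {ffun 'I_m -> 'I_N}) : mindex m := [ffun i => val (g i)].
pose B := [fset tr g | g in {: {ffun 'I_m -> 'I_N}}]%fset.
have AB : (A `<=` B)%fset.
  apply/fsubsetP => al alA.
  have le i : (al i < N)%N.
    rewrite ltnS (big_fsetD1 al) //= (bigD1 i) //= -addnA; exact: leq_addr.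
  apply/imfsetP; exists [ffun i => Ordinal (le i)] => //=.
  by apply/ffunP => i; rewrite !ffunE.
apply: le_trans (ler_sum_fset AB _) _ => [al|]; first exact: normr_ge0.
rewrite big_imfset /=; last first.
  move=> g h _ _ /ffunP gh; apply/ffunP => i; apply: val_inj.
  by have := gh i; rewrite !ffunE.
have -> : \sum_(g <- enum {: {ffun 'I_m -> 'I_N}})
    `|(2^-1 : K) ^+ (\sum_i (tr g) i)| =
    \prod_(i < m) \sum_(j < N) (2^-1 : K) ^+ j.
  rewrite bigA_distr_bigA /= big_enum /=; apply: eq_bigr => g _.
  rewrite ger0_norm ?exprn_ge0 ?invr_ge0 // expr_sum; apply: eq_bigr => i _.
  by rewrite ffunE.
have S0 : 0 <= \sum_(j < N) (2^-1 : K) ^+ j.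
  by apply: sumr_ge0 => j _; rewrite exprn_ge0 ?invr_ge0.
rewrite prodr_const card_ord; apply: lerXn2r; rewrite ?nnegrE //.
have h n : \sum_(j < n) (2^-1 : K) ^+ j = 2 - 2 * 2^-1 ^+ n.
  elim: n => [|n IH]; first by rewrite big_ord0 expr0 mulr1 subrr.
  rewrite big_ord_recr /= IH exprS mulrA divff ?pnatr_eq0 // mul1r.
  by rewrite mulr_natl mulr2n opprD addrA subrK.
by rewrite h gerBl mulr_ge0 // exprn_ge0 ?invr_ge0.
Qed.

(* Convergence at a point bounds the terms there, and halving the radius makes
   them summable. *)
Lemma has_sum_abs_le a (r s : K) : 0 <= r -> has_sum (terms a (radius w r)) s ->
  exists C, abs_le (terms a (radius w (2^-1 * r))) C.
Proof.
move=> r0 /has_sumP/(_ 1 ltr01)[A hA].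
(* For an index outside [A], the partial sums over [A] with and without it are both within 1 of [s],
   so its term is at most 2. Terms inside [A] are bounded by their sum. *)
set f := terms a _ in hA; pose M := 2 + \sum_(i <- A) `|f i|.
have fM i : `|f i| <= M.
  have [iA|iA] := boolP (i \in A).
    by rewrite /M (big_fsetD1 i) //= addrCA lerDl addr_ge0 ?sumr_ge0.
  apply: (@le_trans _ _ 2); last by rewrite lerDl sumr_ge0.
  have h1 := hA A (fsubset_refl _); have h2 := hA (i |` A)%fset (fsubsetU1 _ _).
  rewrite big_fsetU1 //= in h2.
  have -> : f i = (s - \sum_(j <- A) f j) - (s - (f i + \sum_(j <- A) f j)).
    by ring.
  apply: le_trans (ler_normB _ _) _; rewrite -[2]/(1 + 1); exact: lerD (ltW _) (ltW _).
have M0 : 0 <= M by apply: le_trans (fM mzero).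
exists (`|M| * 2 ^+ m).
apply: abs_le_ler (abs_leZ M geometric_bound) => al.
rewrite /terms monomial_radius exprMn mulrCA normrM [leRHS]normrM mulrC.
apply: ler_pM => //.
  by rewrite -monomial_radius (le_trans (fM al)) // ger0_norm.
rewrite !ger0_norm ?exprn_ge0 ?invr_ge0 // ler_wiXn2l ?invr_ge0 ?invf_le1 ?ler1n //.
by apply: leq_sum => i _; rewrite leq_pmull.
Qed.

End Radius.
End Series.

Lemma has_sum_smul (R : realType) (m : nat)
    (a b : mindex m -> complex_field R) z C D s t :
  abs_le (terms a z) C -> abs_le (terms b z) D ->
  has_sum (terms a z) s -> has_sum (terms b z) t ->
  has_sum (terms (smul a b) z) (s * t).
Proof.
move=> ha hb sa sb; rewrite terms_smul.
exact: (has_sum_push (fun al p => splitsP al p) (has_sumM ha hb sa sb)).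
Qed.

(** * The distinguished variable *)

Section LastVariable.
Variables (K : numFieldType) (k : nat).
Implicit Types (e : 'rV[K]_k) (x : K) (al : mindex (k + 1)) (be : mindex k).
Local Notation series := (mindex (k + 1) -> K).

Definition xvar : 'I_(k + 1) := rshift k ord0.

Definition xpow (j : nat) : mindex (k + 1) := [ffun i => if i == xvar then j else 0%N].

Definition eindex be : mindex (k + 1) :=
  [ffun i : 'I_(k + 1) =>
    match fintype.split i with inl i' => be i' | inr _ => 0%N end].

Definition epart al : mindex k := [ffun i => al (lshift 1 i)].

Definition expoint e x : 'rV[K]_(k + 1) := row_mx e (const_mx x).

Lemma point_l e x i : expoint e x ord0 (lshift 1 i) = e ord0 i.
Proof. by rewrite row_mxEl. Qed.

Lemma point_x e x : expoint e x ord0 xvar = x.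
Proof. by rewrite row_mxEr mxE. Qed.

Lemma lshift_xvar (i : 'I_k) : (lshift 1 i == xvar) = false.
Proof. exact: eq_lrshift. Qed.

Lemma var_cases (P : 'I_(k + 1) -> Prop) :
  (forall i, P (lshift 1 i)) -> P xvar -> forall i, P i.
Proof.
move=> hl hx i; case: (fintype.splitP i) => j ij.
  by rewrite (_ : i = lshift 1 j) //; apply: val_inj.
by rewrite (_ : i = xvar) //; apply: val_inj; rewrite /= ij (ord1 j).
Qed.

Lemma xpow_l j i : xpow j (lshift 1 i) = 0%N.
Proof. by rewrite ffunE lshift_xvar. Qed.

Lemma xpow_x j : xpow j xvar = j.
Proof. by rewrite ffunE eqxx. Qed.

Lemma eindex_l be i : eindex be (lshift 1 i) = be i.
Proof. by rewrite ffunE (unsplitK (inl i)). Qed.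

Lemma eindex_x be : eindex be xvar = 0%N.
Proof. by rewrite ffunE (unsplitK (inr ord0)). Qed.

Lemma eindex_inj : injective eindex.
Proof.
by move=> b c /ffunP h; apply/ffunP => i; have := h (lshift 1 i); rewrite !eindex_l.
Qed.

Lemma eindex_epart al : al xvar = 0%N -> eindex (epart al) = al.
Proof.
move=> al0; apply/ffunP; apply: var_cases => [i|]; last by rewrite eindex_x.
by rewrite eindex_l ffunE.
Qed.

Lemma xpow1_pred al : al xvar != 0%N ->
  madd (xpow 1) [ffun i => al i - xpow 1 i]%N = al.
Proof.
move=> al0; apply/ffunP; apply: var_cases => [i|].
  by rewrite ffunE [X in (_ + X)%N]ffunE xpow_l subn0.
by rewrite ffunE [X in (_ + X)%N]ffunE xpow_x subnKC // lt0n.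
Qed.

Lemma monomial_point e x al :
  monomial (expoint e x) al = monomial e (epart al) * x ^+ al xvar.
Proof.
rewrite /monomial big_split_ord /= big_ord1 point_x; congr (_ * _).
by apply: eq_bigr => i _; rewrite point_l ffunE.
Qed.

Lemma monomial_eindex e x be : monomial (expoint e x) (eindex be) = monomial e be.
Proof.
rewrite monomial_point eindex_x expr0 mulr1; congr monomial.
by apply/ffunP => i; rewrite ffunE eindex_l.
Qed.

Lemma monomial_xpow e x j : monomial (expoint e x) (xpow j) = x ^+ j.
Proof.
rewrite monomial_point xpow_x; rewrite (_ : epart _ = mzero) ?monomial_zero ?mul1r //.
by apply/ffunP => i; rewrite !ffunE lshift_xvar.
Qed.

(* [g = slow g + x * sshift g]. *)
Definition sshift (g : series) : series := fun al => g (madd (xpow 1) al).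
Definition slow (g : series) : mindex k -> K := fun be => g (eindex be).

Lemma abs_le_sshift g e x C : x != 0 ->
  abs_le (terms g (expoint e x)) C ->
  abs_le (terms (sshift g) (expoint e x)) (`|x|^-1 * C).
Proof.
move=> x0 hg; rewrite -normfV.
apply: abs_le_ler (abs_leZ x^-1 (abs_le_inj (@maddIr _ (xpow 1)) hg)) => al.
by rewrite /terms monomialD monomial_xpow expr1 mulrCA mulKf.
Qed.

Lemma abs_le_iter_sshift g e x C n : x != 0 ->
  abs_le (terms g (expoint e x)) C ->
  abs_le (terms (iter n sshift g) (expoint e x)) (`|x|^-1 ^+ n * C).
Proof.
move=> x0 hg; elim: n => [|n IH]; first by rewrite expr0 mul1r.
by rewrite exprS -mulrA; apply: abs_le_sshift.
Qed.

Lemma abs_le_slow g e x C :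
  abs_le (terms g (expoint e x)) C -> abs_le (terms (slow g) e) C.
Proof.
move=> hg; apply: abs_le_ler (abs_le_inj eindex_inj hg) => be.
by rewrite /terms monomial_eindex.
Qed.

(** Splits the indices by whether the exponent of x is 0; each half is an injective reindexing of
    the corresponding series. *)
Lemma has_sum_slow_sshift g e x s t :
  has_sum (terms (slow g) e) s -> has_sum (terms (sshift g) (expoint e x)) t ->
  has_sum (terms g (expoint e x)) (s + x * t).
Proof.
move=> hs ht.
pose f0 al := (al xvar == 0%N)%:R * terms g (expoint e x) al.
pose f1 al := (al xvar != 0%N)%:R * terms g (expoint e x) al.
have h0 : has_sum f0 s.
  apply: (has_sum_inj eindex_inj) => [al|].
    rewrite /f0; have [al0 _|_] := eqVneq (al xvar) 0%N; last by rewrite mul0r eqxx.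
    by exists (epart al); exact: eindex_epart.
  apply: eq_has_sum hs => be.
  by rewrite /f0 eindex_x mul1r /terms monomial_eindex.
have h1 : has_sum f1 (x * t).
  apply: (has_sum_inj (@maddIr _ (xpow 1))) => [al|].
    rewrite /f1; have [_|al0 _] := eqVneq (al xvar) 0%N; first by rewrite mul0r eqxx.
    by exists [ffun i => al i - xpow 1 i]%N; exact: xpow1_pred.
  apply: eq_has_sum (has_sumZ x ht) => al.
  by rewrite /f1 ffunE xpow_x mul1r /terms monomialD monomial_xpow expr1 mulrCA.
apply: eq_has_sum (has_sumD h0 h1) => al.
rewrite /f0 /f1; have [_|_] := eqVneq (al xvar) 0%N;
  by rewrite mul1r mul0r ?addr0 ?add0r.
Qed.

(** Taylor expansion in x to order [n] with remainder: the [t q] are the coefficients, and [s n] is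
    the value of the quotient by x^n. *)
Lemma has_sum_iter_sshift g e x n (s t : nat -> K) :
  (forall q, (q <= n)%N -> has_sum (terms (iter q sshift g) (expoint e x)) (s q)) ->
  (forall q, (q < n)%N -> has_sum (terms (slow (iter q sshift g)) e) (t q)) ->
  s 0%N = \sum_(q < n) t q * x ^+ q + x ^+ n * s n.
Proof.
elim: n => [|n IH] hs ht; first by rewrite big_ord0 add0r expr0 mul1r.
rewrite IH => [|q qn|q qn]; [|by apply: hs; exact: leqW|by apply: ht; exact: leqW].
rewrite big_ord_recr /= -addrA; congr (_ + _).
have := has_sum_slow_sshift (ht n (ltnSn n)) (hs n.+1 (leqnn _)).
move=> /(has_sum_unique (hs n (leqnSn n))) ->.
by rewrite exprSr; ring.
Qed.

Variable w : 'I_(k + 1) -> nat.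
Hypothesis wx : w xvar = 1%N.

Lemma weight_xpow j : weight w (xpow j) = j.
Proof.
rewrite /weight (bigD1 xvar) //= xpow_x wx mul1n big1 ?addn0 // => i /negbTE.
by rewrite ffunE => ->; rewrite muln0.
Qed.

(** As x has weight 1, dividing by x^n loses exactly [n] weights of agreement. *)
Lemma agree_iter_sshift d n a b :
  agree w (d + n) a b -> agree w d (iter n sshift a) (iter n sshift b).
Proof.
elim: n d => [|n IH] d; first by rewrite addn0.
rewrite -(addSnnS d n) => /IH h al lt; rewrite /= /sshift; apply: h.
by rewrite weightD weight_xpow.
Qed.

End LastVariable.
Arguments xvar {k}.

(** * Termwise differentiation in x *)

Section Derivative.
Variables (K : numFieldType) (k : nat).
Local Notation series := (mindex (k + 1) -> K).

Definition sderive (a : series) : series :=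
  fun al => (al xvar).+1%:R * a (madd (xpow k 1) al).

(** Halving x turns the factor j + 1 of the derivative into (j + 1) / 2^j, which is at most 2. *)
Lemma abs_le_sderive (a : series) e x C : x != 0 ->
  abs_le (terms a (expoint e x)) C ->
  abs_le (terms (sderive a) (expoint e (2^-1 * x))) (`|2 / x| * C).
Proof.
move=> x0 ha.
apply: abs_le_ler (abs_leZ (2 / x) (abs_le_inj (@maddIr _ (xpow k 1)) ha)) => al.
rewrite /terms /sderive monomialD monomial_xpow expr1 !monomial_point exprMn.
set j := al xvar; set c := a _; set mm := monomial _ _.
have -> : 2 / x * (c * (x * (mm * x ^+ j))) = 2 * (c * mm * x ^+ j) by field.
have -> : j.+1%:R * c * (mm * (2^-1 ^+ j * x ^+ j)) =
  (j.+1%:R * 2^-1 ^+ j) * (c * mm * x ^+ j) by ring.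
rewrite [leLHS]normrM [leRHS]normrM ler_wpM2r //.
rewrite !ger0_norm ?mulr_ge0 ?exprn_ge0 ?invr_ge0 // exprVn ler_pdivrMr ?exprn_gt0 //.
rewrite -exprS -natrX ler_nat expnS mul2n -addnn -addn1 leq_add //.
  by rewrite ltnW // ltn_expl.
by rewrite expn_gt0.
Qed.

(** The remainders satisfy rem_(j+1) = (x + h) rem_j + h^2 j x^(j-1), and 2^j + j <= 2^(j+1) closes
    the induction. The factor [rho ^+ 2] on the left avoids negative powers for small j. *)
Lemma pow_taylor (x h rho : K) (j : nat) :
  `|x| <= rho -> `|x + h| <= rho ->
  `|(x + h) ^+ j - x ^+ j - h * (j%:R * x ^+ j.-1)| * rho ^+ 2
    <= `|h| ^+ 2 * (2 * rho) ^+ j.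
Proof.
move=> hx hxh; have rho0 : 0 <= rho by apply: le_trans hx.
elim: j => [|j IH].
  by rewrite !expr0 subrr mul0r mulr0 subrr normr0 mul0r mulr1 exprn_ge0.
have -> : (x + h) ^+ j.+1 - x ^+ j.+1 - h * (j.+1%:R * x ^+ j) =
  (x + h) * ((x + h) ^+ j - x ^+ j - h * (j%:R * x ^+ j.-1)) +
  h ^+ 2 * (j%:R * x ^+ j.-1).
  case: j {IH} => [|j]; first by rewrite !expr0 !expr1; ring.
  by rewrite !exprS -!natr1 /=; ring.
apply: le_trans (ler_wpM2r _ (ler_normD _ _)) _; first exact: exprn_ge0.
rewrite mulrDl [X in X * _ + _]normrM -mulrA.
apply: (@le_trans _ _ (rho * (`|h| ^+ 2 * (2 * rho) ^+ j) +
   `|h| ^+ 2 * (j%:R * rho ^+ j.+1))).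
  apply: lerD; first by apply: ler_pM => //; rewrite mulr_ge0 ?exprn_ge0.
  rewrite !normrM normrX normr_nat -!mulrA ler_wpM2l ?exprn_ge0 //.
  case: j {IH} => [|j]; first by rewrite !mul0r.
  rewrite ler_wpM2l // ler_wpM2l //= -[j.+2]addn2 exprD ler_wpM2r ?exprn_ge0 //.
  by rewrite lerXn2r ?nnegrE.
rewrite !exprMn [rho ^+ j.+1]exprS.
have -> : rho * (`|h| ^+ 2 * (2 ^+ j * rho ^+ j)) +
    `|h| ^+ 2 * (j%:R * (rho * rho ^+ j)) =
  (`|h| ^+ 2 * (rho * rho ^+ j)) * (2 ^+ j + j%:R) by ring.
rewrite [leRHS](_ : _ = (`|h| ^+ 2 * (rho * rho ^+ j)) * 2 ^+ j.+1); last by ring.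
rewrite ler_wpM2l ?mulr_ge0 ?exprn_ge0 // exprS [leRHS]mulr_natl [leRHS]mulr2n lerD2l.
by rewrite -natrX ler_nat ltnW // ltn_expl.
Qed.

(** Summing [pow_taylor] over all terms against the norm at 2 rho bounds the error of the linear
    approximation by |h|^2 C / rho^2, which gives the derivative directly. *)
Lemma has_sum_derive (a : series) e (f : K -> K) (x rho C d : K) :
  0 < rho -> `|x| < rho ->
  (forall t, `|t| <= rho -> has_sum (terms a (expoint e t)) (f t)) ->
  abs_le (terms a (expoint e (2 * rho))) C ->
  has_sum (terms (sderive a) (expoint e x)) d ->
  derive1 f x = d.
Proof.
move=> rho0 xrho hf ha hd.
(* The derived series indexed by the original exponents, so that it can be subtracted term by term
   from the series of [f]. *)
pose T al := a al * (monomial e (epart al) * ((al xvar)%:R * x ^+ (al xvar).-1)).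
have hT : has_sum T d.
  apply: (has_sum_inj (@maddIr _ (xpow k 1))) => [al|].
    have [al0|al0 _] := eqVneq (al xvar) 0%N.
      by rewrite /T al0 mul0r !mulr0 eqxx.
    by exists [ffun i => al i - xpow k 1 i]%N; exact: xpow1_pred.
  apply: eq_has_sum hd => al.
  rewrite /terms /sderive /T monomial_point ffunE xpow_x /=.
  rewrite (_ : epart (madd _ _) = epart al); first by ring.
  by apply/ffunP => i; rewrite !ffunE lshift_xvar.
have C0 : 0 <= C by exact: abs_le_ge0 ha.
have taylor h : `|x + h| <= rho ->
    `|f (x + h) - f x - h * d| <= `|h| ^+ 2 * (C / rho ^+ 2).
  move=> xh.
  have hs := has_sumD (has_sumD (hf _ xh) (has_sumZ (-1) (hf _ (ltW xrho))))
    (has_sumZ (- h) hT).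
  rewrite mulN1r mulNr in hs.
  apply: has_sum_le hs => [|A].
    by rewrite mulr_ge0 ?exprn_ge0 // divr_ge0 // exprn_ge0 // ltW.
  apply: le_trans (ler_norm_sum _ _ _) _.
  rewrite mulrA ler_pdivlMr ?exprn_gt0 // mulr_suml.
  apply: le_trans (ler_wpM2l (exprn_ge0 2 (normr_ge0 h)) (ha A)).
  rewrite mulr_sumr; apply: ler_sum => al _.
  rewrite /terms /T !monomial_point.
  set c := a _; set mm := monomial _ _; set j := al xvar.
  have -> : c * (mm * (x + h) ^+ j) + -1 * (c * (mm * x ^+ j)) +
     - h * (c * (mm * (j%:R * x ^+ j.-1))) =
     c * mm * ((x + h) ^+ j - x ^+ j - h * (j%:R * x ^+ j.-1)) by ring.
  have X0 : 0 <= (2 * rho) ^+ j by rewrite exprn_ge0 // mulr_ge0 // ltW.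
  rewrite [in leLHS]normrM [c * (mm * (2 * rho) ^+ j)]mulrA [in leRHS]normrM.
  rewrite (ger0_norm X0) -[leLHS]mulrA [leRHS]mulrCA ler_wpM2l //.
  by apply: pow_taylor => //; exact: ltW.
apply: cvg_lim => //; apply/cvgrPdist_le => eps eps0.
have M0 : 0 < C / rho ^+ 2 + 1 by rewrite ltr_wpDl // divr_ge0 // exprn_ge0 // ltW.
near=> h.
have h0 : h != 0 by near: h; exact: nbhs_dnbhs_neq.
have hr : `|h| <= rho - `|x|.
  near: h; apply: dnbhs0_le; by rewrite subr_gt0.
have he : `|h| <= eps / (C / rho ^+ 2 + 1).
  near: h; apply: dnbhs0_le; by rewrite divr_gt0.
have xh : `|x + h| <= rho.
  by rewrite (le_trans (ler_normD _ _)) // addrC -lerBrDr.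
have -> : d - h^-1 *: (f (h + x) - f x) = - (h^-1 * (f (x + h) - f x - h * d)).
  by rewrite /GRing.scale /= [h + x]addrC; field.
rewrite normrN normrM normfV ler_pdivrMl ?normr_gt0 //.
apply: le_trans (taylor _ xh) _; rewrite expr2 -mulrA ler_wpM2l //.
rewrite ler_pdivlMr // in he; apply: le_trans he.
by rewrite ler_wpM2l // lerDl.
Unshelve. all: by end_near.
Qed.

End Derivative.

(** * Weierstrass division *)

Definition ssummable (K : numFieldType) (m : nat) (a : mindex m -> K) (z : 'rV[K]_m) :=
  exists C, abs_le (terms a z) C.

(** A total function, with value 0 where there is no sum, so that it can represent a germ. *)
Definition ssum (K : numFieldType) (m : nat) (a : mindex m -> K) (z : 'rV[K]_m) : K :=
  xget 0 (has_sum (terms a z)).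

(** * Evaluation of absolutely summable series *)

Section Sums.
Variables (R : realType) (m : nat).
Local Notation K := (complex_field R).
Local Notation series := (mindex m -> K).
Implicit Types (a b : series) (z : 'rV[K]_m).

Lemma has_ssum a z : ssummable a z -> has_sum (terms a z) (ssum a z).
Proof. by move=> [C /has_sum_exists[s hs]]; exact: (xgetPex 0 (ex_intro _ s hs)). Qed.

Lemma ssumE a z s : has_sum (terms a z) s -> ssum a z = s.
Proof. by move=> hs; exact: (has_sum_unique (xgetPex 0 (ex_intro _ s hs)) hs). Qed.

Lemma ssummable_disc a z z' : (forall i, `|z ord0 i| <= `|z' ord0 i|) ->
  ssummable a z' -> ssummable a z.
Proof. by move=> h [C hC]; exists C; apply: abs_le_terms_disc hC. Qed.

Lemma ssummableD a b z : ssummable a z -> ssummable b z ->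
  ssummable (fun al => a al + b al) z.
Proof. by move=> [C ha] [D hb]; exists (C + D); exact: abs_le_termsD. Qed.

Lemma ssummableZ c a z : ssummable a z -> ssummable (fun al => c * a al) z.
Proof. by move=> [C ha]; exists (`|c| * C); exact: abs_le_termsZ. Qed.

Lemma ssummableN a z : ssummable a z -> ssummable (fun al => - a al) z.
Proof. by move=> [C ha]; exists C; exact: abs_le_termsN. Qed.

Lemma ssummableM a b z : ssummable a z -> ssummable b z -> ssummable (smul a b) z.
Proof. by move=> [C ha] [D hb]; exists (C * D); exact: abs_le_smul. Qed.

Lemma ssummable_sum (T : finType) (a : T -> series) z :
  (forall t, ssummable (a t) z) -> ssummable (fun al => \sum_t a t al) z.
Proof.
by move=> ha; exists (\sum_t sval (cid (ha t))); apply: abs_le_terms_sum => t;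
  exact: (svalP (cid (ha t))).
Qed.

Lemma ssummable_mono be z : ssummable (smono K be) z.
Proof. by exists `|monomial z be|; exact: abs_le_smono. Qed.

Lemma ssumD a b z : ssummable a z -> ssummable b z ->
  ssum (fun al => a al + b al) z = ssum a z + ssum b z.
Proof. by move=> ha hb; apply/ssumE/has_sum_termsD; exact: has_ssum. Qed.

Lemma ssumZ c a z : ssummable a z -> ssum (fun al => c * a al) z = c * ssum a z.
Proof. by move=> ha; apply/ssumE/has_sum_termsZ; exact: has_ssum. Qed.

Lemma ssumN a z : ssummable a z -> ssum (fun al => - a al) z = - ssum a z.
Proof. by move=> ha; apply/ssumE/has_sum_termsN; exact: has_ssum. Qed.

Lemma ssumM a b z : ssummable a z -> ssummable b z ->
  ssum (smul a b) z = ssum a z * ssum b z.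
Proof.
move=> ha hb; have [[C hC] [D hD]] := (ha, hb).
by apply/ssumE/(has_sum_smul hC hD); exact: has_ssum.
Qed.

Lemma ssum_sum (T : finType) (a : T -> series) z :
  (forall t, ssummable (a t) z) ->
  ssum (fun al => \sum_t a t al) z = \sum_t ssum (a t) z.
Proof. by move=> ha; apply/ssumE/has_sum_terms_sum => t; exact: has_ssum. Qed.

Lemma ssum_mono be z : ssum (smono K be) z = monomial z be.
Proof. exact/ssumE/has_sum_smono. Qed.

Lemma near_disc (rho : K) : 0 < rho ->
  \forall z \near (0 : 'rV[K]_m), forall i, `|(z : 'rV[K]_m) ord0 i| <= rho.
Proof.
move=> rho0; apply/nbhs_ballP; exists rho => //= z [_ hz] i.
by have := hz ord0 i; rewrite /ball /= mxE sub0r normrN => /ltW.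
Qed.

Lemma analytic_ssum (a : series) (z0 : 'rV[K]_m) (rho : K) : 0 < rho ->
  (forall i, rho <= `|z0 ord0 i|) -> ssummable a z0 -> analytic_at0 (ssum a).
Proof.
move=> rho0 hz0 ha; exists a; near=> z.
apply/has_ssum/(ssummable_disc _ ha) => i.
apply: le_trans (hz0 i); move: i; near: z; exact: near_disc.
Unshelve. all: by end_near.
Qed.

End Sums.

(** * Division by the unfolding *)

Section Division.
Variables (R : realType) (k : nat).
Local Notation K := (complex_field R).
Local Notation series := (mindex (k + 1) -> K).

(* With these weights, multiplication by [e_i x^i] followed by division by
   [x^(k+1)] raises the weight. *)
Definition uweight (i : 'I_(k + 1)) : nat := if i == xvar then 1%N else k.+2.

Lemma uweight_x : uweight xvar = 1%N.
Proof. by rewrite /uweight eqxx. Qed.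

Lemma uweight_gt0 i : (0 < uweight i)%N.
Proof. by rewrite /uweight; case: ifP. Qed.

Lemma radius_uweight (r : K) : radius uweight r = expoint (const_mx (r ^+ k.+2)) r.
Proof.
apply/rowP; apply: var_cases => [i|].
  by rewrite point_l !mxE /uweight lshift_xvar.
by rewrite point_x mxE uweight_x expr1.
Qed.

(** The closed polydisc with corner [radius uweight r], whence the exponent for e. *)
Definition disc (r : K) (e : 'rV[K]_k) (x : K) :=
  (forall i, `|e ord0 i| <= r ^+ k.+2) /\ `|x| <= r.

Lemma disc_radius (r : K) e (x : K) : 0 <= r -> disc r e x ->
  forall i, `|expoint e x ord0 i| <= `|radius uweight r ord0 i|.
Proof.
move=> r0 [he hx]; rewrite radius_uweight; apply: var_cases => [i|].
  by rewrite !point_l mxE [leRHS]ger0_norm ?exprn_ge0.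
by rewrite !point_x [leRHS]ger0_norm.
Qed.

Definition emono (i : 'I_k) : mindex (k + 1) :=
  madd (eindex [ffun j => (j == i) : nat]) (xpow k i).

Lemma monomial_emono (e : 'rV[K]_k) (x : K) i :
  monomial (expoint e x) (emono i) = e ord0 i * x ^+ i.
Proof.
rewrite monomialD monomial_xpow monomial_eindex /monomial (bigD1 i) //=.
rewrite ffunE eqxx expr1 big1 ?mulr1 // => j /negbTE ji.
by rewrite ffunE ji expr0.
Qed.

Lemma weight_emono i : (k.+2 <= weight uweight (emono i))%N.
Proof.
rewrite weightD; apply: leq_trans (leq_addr _ _).
rewrite /weight (bigD1 (lshift 1 i)) //= eindex_l ffunE eqxx muln1.
by rewrite /uweight lshift_xvar leq_addr.
Qed.

Definition unfolding_tail : series := fun al => \sum_(i < k) smono K (emono i) al.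

Lemma ssummable_tail z : ssummable unfolding_tail z.
Proof. by apply: ssummable_sum => i; exact: ssummable_mono. Qed.

Lemma ssum_tail (e : 'rV[K]_k) (x : K) :
  ssum unfolding_tail (expoint e x) = \sum_(i < k) e ord0 i * x ^+ i.
Proof.
rewrite ssum_sum => [|i]; last exact: ssummable_mono.
by apply: eq_bigr => i _; rewrite ssum_mono monomial_emono.
Qed.

Lemma unfolding_tail_low al : (weight uweight al < k.+2)%N -> unfolding_tail al = 0.
Proof.
move=> lt; rewrite /unfolding_tail big1 // => i _; rewrite /smono.
case: eqP => // ali; move: lt.
by rewrite ali ltnNge weight_emono.
Qed.

Lemma abs_le_tail (r : K) : 0 <= r -> r <= 1 ->
  abs_le (terms unfolding_tail (radius uweight r)) (k%:R * r ^+ k.+2).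
Proof.
move=> r0 r1.
apply: (@abs_leW _ _ _ (\sum_(i < k) `|monomial (radius uweight r) (emono i)|)).
  have -> : k%:R * r ^+ k.+2 = \sum_(i < k) r ^+ k.+2.
    by rewrite sumr_const card_ord mulr_natl.
  apply: ler_sum => i _.
  rewrite monomial_radius ger0_norm ?exprn_ge0 //.
  by apply: ler_wiXn2l => //; exact: weight_emono.
by apply: abs_le_terms_sum => i; exact: abs_le_smono.
Qed.

(* With [E = unfolding_tail], [p = x^(k+1) + E], so [d = lam + p q] means that
   [q] is the quotient of [d - E q] by [x^(k+1)]: a contraction in [q]. *)
Lemma weierstrass_division (d : series) (r : K) :
  0 < r -> r <= 1 -> k%:R * r <= 2^-1 -> ssummable d (radius uweight r) ->
  exists (q : series) (lam : 'I_k.+1 -> mindex k -> K),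
    [/\ ssummable q (radius uweight r),
        forall i, ssummable (lam i) (const_mx (r ^+ k.+2)) &
        forall e x, disc r e x ->
          ssum d (expoint e x) = \sum_(i < k.+1) ssum (lam i) e * x ^+ i +
            unfolding e x * ssum q (expoint e x)].
Proof.
move=> r0 r1 kr [C hC].
have rn0 : r != 0 by rewrite gt_eqF.
pose h (q : series) : series := fun al => d al - smul unfolding_tail q al.
pose G (q : unit -> series) (_ : unit) := iter k.+1 (@sshift K k) (h (q tt)).
(* The bound kept by [G]: an iterate has norm at most r^-(k+1) C + k r D, and this is at most D/2 +
   D/2 since k r <= 1/2. *)
pose D := 2 * ((r^-1) ^+ k.+1 * C).
have C0 : 0 <= C by exact: abs_le_ge0 hC.
have D0 : 0 <= D by rewrite !mulr_ge0 ?exprn_ge0 ?invr_ge0 // ltW.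
have hb q : abs_le (terms q (radius uweight r)) D ->
    abs_le (terms (h q) (radius uweight r)) (C + k%:R * r ^+ k.+2 * D).
  move=> hq; apply: abs_le_termsD => //; apply: abs_le_termsN.
  by apply: abs_le_smul => //; apply: abs_le_tail => //; exact: ltW.
have [||q0 [qE hq]] := @series_fixpoint K _ uweight unit G (radius uweight r) D D0.
- move=> n X Y XY [] ; apply: agree_iter_sshift; first exact: uweight_x.
  move=> al lt; rewrite /h; congr (_ - _).
  (* The tail gains k + 2 weights and the division by x^(k+1) loses k + 1, a net gain of one. *)
  apply: (agree_smulr (s := k.+2) unfolding_tail_low (XY tt)).
  by rewrite -(addSnnS n k.+1).
- move=> X hX []; rewrite /G.
  have := hb _ (hX tt); rewrite radius_uweight => /(abs_le_iter_sshift k.+1 rn0).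
  apply: abs_leW; rewrite mulrDr.
  have -> : `|r|^-1 = r^-1 by rewrite gtr0_norm.
  have -> : r^-1 ^+ k.+1 * (k%:R * r ^+ k.+2 * D) = k%:R * r * D.
    rewrite [r ^+ k.+2]exprSr exprVn; field.
    by rewrite expf_neq0.
  have -> : r^-1 ^+ k.+1 * C = 2^-1 * D by rewrite /D mulKf // pnatr_eq0.
  rewrite -mulrDl [leRHS](_ : _ = (2^-1 + 2^-1) * D); last by field.
  by rewrite ler_wpM2r // lerD2l.
pose q := q0 tt.
pose lam (i : 'I_k.+1) := slow (iter i (@sshift K k) (h q)).
have hhq := hb _ (hq tt).
have hlam (i : nat) :
    ssummable (slow (iter i (@sshift K k) (h q))) (const_mx (r ^+ k.+2)).
  move: hhq; rewrite radius_uweight => /(abs_le_iter_sshift i rn0)/abs_le_slow hi.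
  by eexists; exact: hi.
exists q, lam; split=> [|i|e x hex]; [by exists D; exact: hq|exact: hlam|].
have zr := disc_radius (ltW r0) hex.
have hd : ssummable d (expoint e x) by apply: ssummable_disc zr _; exists C.
have sq : ssummable q (expoint e x) by apply: ssummable_disc zr _; exists D; exact: hq.
have hs i : ssummable (iter i (@sshift K k) (h q)) (expoint e x).
  apply: ssummable_disc zr _; move: hhq; rewrite radius_uweight.
  by move=> /(abs_le_iter_sshift i rn0) hi; eexists; exact: hi.
have hl i : ssummable (slow (iter i (@sshift K k) (h q))) e.
  apply: ssummable_disc (hlam i) => j.
  by rewrite mxE [leRHS]ger0_norm ?exprn_ge0 ?(ltW r0) //; case: hex.
(* Taylor expansion of d - E q: its coefficients up to x^k are the [lam], and its quotient by
   x^(k+1) is q itself by the fixed-point equation. *)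
have := has_sum_iter_sshift (n := k.+1) (fun i _ => has_ssum (hs i))
  (fun i _ => has_ssum (hl i)).
rewrite /= -/(iter k.+1 (@sshift K k) (h q)).
have -> : ssum (iter k.+1 (@sshift K k) (h q)) (expoint e x) = ssum q (expoint e x).
  by congr ssum; apply/funext => al; rewrite /q qE.
have -> : ssum (h q) (expoint e x) = ssum d (expoint e x) -
    (\sum_(i < k) e ord0 i * x ^+ i) * ssum q (expoint e x).
  rewrite /h ssumD //; last first.
    by apply: ssummableN; apply: ssummableM => //; exact: ssummable_tail.
  rewrite ssumN; last by apply: ssummableM => //; exact: ssummable_tail.
  by rewrite ssumM ?ssum_tail //; exact: ssummable_tail.
move=> /(canRL (subrK _)) ->; rewrite /unfolding mulrDl -!addrA; congr (_ + _).
Qed.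

End Division.

(** * Matrices of power series *)

(** The hypothesis forces X_ii = 0, so the diagonal entries of the identity hold by the choice of
    D_jj = b_j + C_jj + (C X)_jj. With this D, entry (i, j) off the diagonal is the hypothesis
    multiplied by b_i - b_j. *)
Lemma offdiag_equation_conj (F : fieldType) (n : nat) (b : 'I_n -> F) (C X : 'M[F]_n) :
  injective b ->
  (forall i j, X i j = (i != j)%:R * ((b i - b j)^-1 *
     (- C i j - (C *m X) i j + (X i j * C j j + X i j * (C *m X) j j)))) ->
  (diag_mx (\row_i b i) + C) *m (1%:M + X) =
  (1%:M + X) *m diag_mx (\row_j (b j + C j j + (C *m X) j j)).
Proof.
move=> binj eX; rewrite mulmxDr mulmx1 [in RHS]mulmxDl mul1mx mulmxDl.
move: (C *m X) eX => CX eX; apply/matrixP => i j.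
rewrite mul_diag_mx mul_mx_diag !mxE.
have [<-|ij] := eqVneq i j.
  have -> : X i i = 0 by rewrite eX eqxx mul0r.
  by rewrite !mulr1n; ring.
have bij : b i - b j != 0 by rewrite subr_eq0 (inj_eq binj).
have := congr1 (fun t => (b i - b j) * t) (eX i j).
rewrite ij mul1r mulVKf // => e0; rewrite !mulr0n.
apply/eqP; rewrite -subr_eq0; apply/eqP.
transitivity ((b i - b j) * X i j -
  (- C i j - CX i j + (X i j * C j j + X i j * CX j j))); first by ring.
by rewrite e0 subrr.
Qed.

Section MatrixSeries.
Variables (R : realType) (m n : nat).
Local Notation K := (complex_field R).
Local Notation series := (mindex m -> K).
Local Notation mseries := ('I_n -> 'I_n -> series).
Implicit Types (A B : mseries) (z : 'rV[K]_m).

Definition mssum A z : 'M[K]_n := \matrix_(i, j) ssum (A i j) z.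

Lemma mssumE A z i j : mssum A z i j = ssum (A i j) z.
Proof. exact: mxE. Qed.

Definition mmul A B : mseries := fun i j al => \sum_l smul (A i l) (B l j) al.

Definition mone : mseries := fun i j al => (i == j)%:R * smono K mzero al.

Lemma ssummable_mmul A B z :
  (forall i j, ssummable (A i j) z) -> (forall i j, ssummable (B i j) z) ->
  forall i j, ssummable (mmul A B i j) z.
Proof. by move=> hA hB i j; apply: ssummable_sum => l; exact: ssummableM. Qed.

Lemma mssumM A B z :
  (forall i j, ssummable (A i j) z) -> (forall i j, ssummable (B i j) z) ->
  mssum (mmul A B) z = mssum A z *m mssum B z.
Proof.
move=> hA hB; apply/matrixP => i j; rewrite !mxE ssum_sum => [|l]; last exact: ssummableM.
by apply: eq_bigr => l _; rewrite !mssumE ssumM.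
Qed.

Lemma ssummable_mone i j z : ssummable (mone i j) z.
Proof. by apply: ssummableZ; exact: ssummable_mono. Qed.

Lemma ssum_mone i j z : ssum (mone i j) z = (i == j)%:R.
Proof.
by rewrite ssumZ ?ssum_mono ?monomial_zero ?mulr1 //; exact: ssummable_mono.
Qed.

Lemma mmul_zero A B i j : (forall l, A i l mzero = 0) -> mmul A B i j mzero = 0.
Proof. by move=> A0; rewrite /mmul big1 // => l _; rewrite smul_zero. Qed.

Lemma abs_le_mmul A B z C D i j :
  (forall l, abs_le (terms (A i l) z) C) -> (forall l, abs_le (terms (B l j) z) D) ->
  abs_le (terms (mmul A B i j) z) (n%:R * (C * D)).
Proof.
move=> hA hB; have -> : n%:R * (C * D) = \sum_(l < n) C * D.
  by rewrite sumr_const card_ord mulr_natl.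
by apply: abs_le_terms_sum => l; exact: abs_le_smul.
Qed.

Lemma abs_le_mone i j z : abs_le (terms (mone i j) z) 1.
Proof.
apply: (abs_leW _ (abs_le_termsZ _ (abs_le_smono mzero z))).
by rewrite monomial_zero normr1 mulr1 normr_nat; case: eqP.
Qed.

Variable w : 'I_m -> nat.
Hypothesis w_gt0 : forall i, (0 < w i)%N.

Lemma agree_mmulr d A B B' i j : (forall l, A i l mzero = 0) ->
  (forall l, agree w d (B l j) (B' l j)) ->
  agree w d.+1 (mmul A B i j) (mmul A B' i j).
Proof.
move=> A0 hB al lt; apply: eq_bigr => l _.
apply: (agree_smulr (s := 1%N) _ (hB l)); last by rewrite addn1.
move=> be; rewrite ltnS leqn0 => /eqP be0.
have [->|/(weight_gt0 w_gt0)] := eqVneq be mzero; first exact: A0.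
by rewrite be0.
Qed.

(* A fixed point of [offdiag_step] solves the off-diagonal equations of
   [(diag b + C) (1 + X) = (1 + X) D] with [D] diagonal and [X] zero on the
   diagonal, after elimination of [D]. *)
Definition offdiag_step (b : 'I_n -> K) (C X : mseries) : mseries := fun i j al =>
  (i != j)%:R * ((b i - b j)^-1 * (- C i j al - mmul C X i j al
    + (smul (X i j) (C j j) al + smul (X i j) (mmul C X j j) al))).

(** Every product in [offdiag_step] has a factor from [C], which vanishes at 0, so a step gains one
    weight. The bound 1/(2n) on X is the one that later makes 1 + X invertible. *)
Lemma diagonalize_series (b : 'I_n -> K) (C : mseries) z (M g : K) :
  (0 < n)%N -> 0 <= M -> 0 <= g ->
  (forall i j, i != j -> `|(b i - b j)^-1| <= M) ->
  (forall i j, C i j mzero = 0) ->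
  (forall i j, abs_le (terms (C i j) z) g) ->
  6 * n%:R * M * g <= 1 ->
  exists X, [/\ forall i j, X i j =1 offdiag_step b C X i j,
    forall i j, X i j mzero = 0 &
    forall i j, abs_le (terms (X i j) z) (2 * n%:R)^-1].
Proof.
move=> n0 M0 g0 hM C0 hC small.
pose c : K := (2 * n%:R)^-1.
have nR : 0 < n%:R :> K by rewrite ltr0n.
have c0 : 0 <= c by rewrite invr_ge0 mulr_ge0 // ltW.
pose u (X : 'I_n * 'I_n -> series) : mseries := fun i j => X (i, j).
pose G (X : 'I_n * 'I_n -> series) (p : 'I_n * 'I_n) := offdiag_step b C (u X) p.1 p.2.
have [||X [XE hX]] := @series_fixpoint K _ w _ G z c c0.
- move=> d X Y XY [i j] al lt; rewrite /G /offdiag_step /=.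
  have CXY l : agree w d.+1 (mmul C (u X) l j) (mmul C (u Y) l j).
    by apply: agree_mmulr => // h; exact: XY.
  congr (_ * (_ * (_ - _ + (_ + _)))).
  + exact: CXY.
  + apply: (agree_smul w_gt0 (d := d)) => //; exact: XY.
  + apply: (agree_smul w_gt0 (d := d)) => //; rewrite ?mmul_zero //; exact: XY.
- move=> X hX [i j]; rewrite /G /=.
  have hCX l : abs_le (terms (mmul C (u X) l j) z) (n%:R * (g * c)).
    by apply: abs_le_mmul => // h; exact: hX.
  have hXC := abs_le_smul (hX (i, j)) (hC j j).
  have hXCX := abs_le_smul (hX (i, j)) (hCX j).
  have := abs_le_termsZ (i != j)%:R (abs_le_termsZ (b i - b j)^-1
    (abs_le_termsD (abs_le_termsD (abs_le_termsN (hC i j)) (abs_le_termsN (hCX i)))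
                   (abs_le_termsD hXC hXCX))).
  apply: abs_leW; case: eqP => [|/eqP ij] /=; first by rewrite normr0 mul0r.
  rewrite normr1 mul1r.
  have nc : n%:R * c = 2^-1 by rewrite /c; field; rewrite gt_eqF.
  have -> : n%:R * (g * c) = g * 2^-1 by rewrite mulrCA nc.
  have c1 : c <= 2^-1.
    by rewrite -nc ler_peMl // ler1n.
  (* With c = 1/(2n), so that n c = 1/2, the four summands have norms at most g, g/2, c g and c g/2,
     in all at most 3 g; the smallness hypothesis says that 3 M g <= c. *)
  apply: (@le_trans _ _ (M * (3 * g))).
    apply: ler_pM => //; [by rewrite !addr_ge0 ?mulr_ge0 ?invr_ge0|exact: hM|].
    rewrite [leRHS](_ : _ = g + g * 2^-1 + (1 * g + 2^-1 * g)); last by field.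
    rewrite lerD2l; apply: lerD; apply: ler_pM; rewrite ?mulr_ge0 ?invr_ge0 //.
      by rewrite (le_trans c1) // invf_le1 ?ler1n.
    by rewrite ler_piMr // invf_le1 ?ler1n.
  rewrite /c -[leRHS]mul1r ler_pdivlMr ?mulr_gt0 //.
  by apply: le_trans small; rewrite le_eqVlt; apply/orP; left; apply/eqP; ring.
exists (u X); split=> i j; [exact: (XE (i, j))| |exact: hX].
rewrite /u XE /G /offdiag_step /= C0 mmul_zero // -/(u X i j).
suff h c' : c' mzero = 0 -> smul (u X i j) c' mzero = 0.
  by rewrite !h ?mmul_zero // ?subrr ?oppr0 ?subr0 ?addr0 !mulr0.
move=> c'0; rewrite /smul big_seq big1 // => p.
by rewrite splitsP madd_eq0 => /andP[_ /eqP ->]; rewrite c'0 mulr0.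
Qed.

Lemma mssum_diagonalize (b : 'I_n -> K) (C X : mseries) z :
  injective b -> (forall i j, X i j =1 offdiag_step b C X i j) ->
  (forall i j, ssummable (C i j) z) -> (forall i j, ssummable (X i j) z) ->
  (diag_mx (\row_i b i) + mssum C z) *m (1%:M + mssum X z) =
  (1%:M + mssum X z) *m
    diag_mx (\row_j (b j + ssum (C j j) z + ssum (mmul C X j j) z)).
Proof.
move=> binj XE hC hX; have hCX := ssummable_mmul hC hX.
have := mssumM hC hX; have := mssumE (mmul C X) z.
have := mssumE X z; have := mssumE C z.
move: (mssum C z) (mssum X z) (mssum (mmul C X) z) => C' X' CX' eC eX eCX CXE.
have -> : (\row_j (b j + ssum (C j j) z + ssum (mmul C X j j) z)) =
    (\row_j (b j + C' j j + (C' *m X') j j)).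
  by apply/rowP => j; rewrite [LHS]mxE [RHS]mxE -CXE eC eCX.
apply: offdiag_equation_conj => // i j; rewrite -CXE eX !eC !eCX.
transitivity (ssum (offdiag_step b C X i j) z).
  by congr ssum; exact/funext/XE.
have h1 := ssummableN (hC i j); have h2 := ssummableN (hCX i j).
have h3 := ssummableM (hX i j) (hC j j); have h4 := ssummableM (hX i j) (hCX j j).
have h12 := ssummableD h1 h2; have h34 := ssummableD h3 h4.
have h := ssummableD h12 h34.
rewrite [LHS](ssumZ _ (ssummableZ _ h)) (ssumZ _ h) (ssumD h12 h34).
rewrite (ssumD h1 h2) (ssumD h3 h4) (ssumN (hC i j)) (ssumN (hCX i j)).
by rewrite (ssumM (hX i j) (hC j j)) (ssumM (hX i j) (hCX j j)).
Qed.

(** Fixed point of Q = 1 - X Q. The bound 2 is kept because 1 + n (1/(2n)) 2 = 2. *)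
Lemma inverse_series (X : mseries) z :
  (0 < n)%N -> (forall i j, X i j mzero = 0) ->
  (forall i j, abs_le (terms (X i j) z) (2 * n%:R)^-1) ->
  exists Q : mseries, (forall i j, ssummable (Q i j) z) /\
    forall z', (forall i, `|z' ord0 i| <= `|z ord0 i|) ->
      (1%:M + mssum X z') *m mssum Q z' = 1%:M.
Proof.
move=> n0 X0 hX.
have nR : 0 < n%:R :> K by rewrite ltr0n.
pose u (Q : 'I_n * 'I_n -> series) : mseries := fun i j => Q (i, j).
pose G (Q : 'I_n * 'I_n -> series) (p : 'I_n * 'I_n) : series :=
  fun al => mone p.1 p.2 al - mmul X (u Q) p.1 p.2 al.
have [|||Q [QE hQ]] := @series_fixpoint K _ w _ G z 2.
- by [].
- move=> d Q Q' QQ [i j] al lt; rewrite /G; congr (_ - _).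
  by apply: agree_mmulr lt => // l; exact: QQ.
- move=> Q hQ [i j].
  have := abs_le_termsD (abs_le_mone i j z)
    (abs_le_termsN (@abs_le_mmul X (u Q) z _ _ i j (hX i) (fun l => hQ (l, j)))).
  apply: abs_leW; rewrite le_eqVlt; apply/orP; left; apply/eqP.
  by field; rewrite gt_eqF.
exists (u Q); split=> [i j|z' hz]; first by exists 2; exact: hQ.
have sX i j : ssummable (X i j) z' by apply: ssummable_disc hz _; eexists; exact: hX.
have sQ i j : ssummable (u Q i j) z' by apply: ssummable_disc hz _; eexists; exact: hQ.
rewrite mulmxDl mul1mx -mssumM //; apply/matrixP => i j; rewrite !mxE.
have sXQ := ssummable_mmul sX sQ i j.
rewrite {1}(_ : u Q i j = G Q (i, j)); last exact/funext/QE.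
rewrite /G /= ssumD ?ssum_mone ?ssumN ?subrK //; [exact: ssummable_mone|exact: ssummableN].
Qed.

End MatrixSeries.

(** Each eigenvalue of a diagonal matrix is a diagonal entry; n distinct values among n entries
    leave no room for a repetition. *)
Lemma distinct_eigenvalues_diag (K : numFieldType) (n : nat) (M : 'M[K]_n) :
  is_diag_mx M -> distinct_eigenvalues M -> injective (fun i => M i i).
Proof.
move=> /is_diag_mxP dM [s [us ss /allP es]].
have sub : {subset s <= codom (fun i => M i i)}.
  move=> a /es /eigenvalueP[v vM v0].
  have [j vj] : exists j, v ord0 j != 0.
    apply/existsP; apply: contraNT v0; rewrite negb_exists => /forallP h.
    by apply/eqP/rowP => j; rewrite mxE; apply/eqP; rewrite -[_ == _]negbK.
  have : (v *m M) ord0 j = (a *: v) ord0 j by rewrite vM.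
  rewrite !mxE (bigD1 j) //= big1 ?addr0 => [|i ij].
    by rewrite mulrC => /(mulIf vj) <-; exact: codom_f.
  by rewrite dM ?mulr0.
have := leq_size_uniq us sub; rewrite size_codom card_ord ss leqnn => /(_ isT).
by move/injectiveP.
Qed.

(** * Power series expansion of analytic matrices *)

Section Expansion.
Variables (R : realType) (k n : nat).
Local Notation K := (complex_field R).
Local Notation series := (mindex (k + 1) -> K).

Lemma point_submx (z : 'rV[K]_(k + 1)) : expoint (lsubmx z) (rsubmx z ord0 ord0) = z.
Proof.
by apply/rowP; apply: var_cases => [i|]; rewrite ?point_l ?point_x !mxE.
Qed.

Lemma analytic_mssum (A : 'I_n -> 'I_n -> series) (z0 : 'rV[K]_(k + 1)) (rho : K) :
  0 < rho -> (forall i, rho <= `|z0 ord0 i|) ->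
  (forall i j, ssummable (A i j) z0) ->
  analytic_mx (fun e x => mssum A (expoint e x)).
Proof.
move=> rho0 hz0 hA i j; rewrite /analytic2_at0.
rewrite (_ : (fun z => _) = ssum (A i j)); last first.
  by apply/funext => z; rewrite point_submx mssumE.
exact: (analytic_ssum rho0 hz0 (hA i j)).
Qed.

Lemma near_disc_point (rho : K) : 0 < rho ->
  \forall e \near (0 : 'rV[K]_k) & x \near (0 : K),
    (forall i, `|(e : 'rV[K]_k) ord0 i| <= rho ^+ k.+2) /\ `|x| < 2^-1 * rho.
Proof.
move=> rho0; have rk : 0 < rho ^+ k.+2 by rewrite exprn_gt0.
exists ([set e : 'rV[K]_k | forall i, `|e ord0 i| <= rho ^+ k.+2],
        [set x : K | `|x| < 2^-1 * rho]) => //=.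
split; first exact: near_disc.
apply/nbhs_ballP; exists (2^-1 * rho) => /=; first by rewrite mulr_gt0 // invr_gt0.
by move=> x; rewrite /ball /= sub0r normrN.
Qed.

Lemma analytic_mx_expansion (B : 'rV[K]_k -> K -> 'M[K]_n) :
  analytic_mx B -> exists (A : 'I_n -> 'I_n -> series) (r : K),
    [/\ 0 < r, r <= 1, forall i j, ssummable (A i j) (radius (@uweight k) r) &
        forall e x, disc r e x -> B e x = mssum A (expoint e x)].
Proof.
move=> hB; pose A i j := sval (cid (hB i j)).
pose P i j (z : 'rV[K]_(k + 1)) :=
  has_sum (terms (A i j) z) (B (lsubmx z) (rsubmx z ord0 ord0) i j).
have hP i j : \forall z \near (0 : 'rV[K]_(k + 1)), P i j z.
  exact: (svalP (cid (hB i j))).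
have FF : Filter (nbhs (0 : 'rV[K]_(k + 1))) by exact: nbhs_filter.
have hA := filter_forall FF (f := fun i z => forall j, P i j z)
  (fun i => filter_forall FF (f := fun j z => P i j z) (hP i)).
have [eps /= eps0 heps] : exists2 eps : K, 0 < eps & forall z : 'rV[K]_(k + 1),
    (forall i, `|z ord0 i| < eps) -> forall i j,
    has_sum (terms (A i j) z) (B (lsubmx z) (rsubmx z ord0 ord0) i j).
  move: hA => /nbhs_ballP[eps eps0 h]; exists eps => // z hz; apply: h; split => //.
  by move=> i j; rewrite /ball /= mxE sub0r normrN (ord1 i).
(* Less than [eps] and at most 1, in one formula. *)
pose r1 := eps / (1 + eps).
have e1 : 0 < 1 + eps by rewrite addr_gt0.
have r10 : 0 < r1 by rewrite divr_gt0.
have r11 : r1 <= 1 by rewrite ler_pdivrMr // mul1r lerDr.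
have r1e : r1 < eps.
  by rewrite ltr_pdivrMr // mulrDr mulr1 ltrDl mulr_gt0.
have hs e x : disc r1 e x -> forall i j,
    has_sum (terms (A i j) (expoint e x)) (B e x i j).
  move=> [he hx] i j.
  have := heps (expoint e x) _ i j; rewrite row_mxKl row_mxKr mxE; apply.
  apply: var_cases => [l|]; last by rewrite point_x (le_lt_trans hx).
  rewrite point_l (le_lt_trans (he l)) // (le_lt_trans _ r1e) //.
  by rewrite exprS ler_piMr ?(ltW r10) // exprn_ile1 // ltW.
(* The series converge at radius [r1]; halving it makes them absolutely summable. *)
exists A, (2^-1 * r1); split.
- by rewrite mulr_gt0 // invr_gt0.
- by rewrite mulr_ile1 ?invr_ge0 ?(ltW r10) // invf_le1 ?ler1n.
- move=> i j; apply: has_sum_abs_le; [exact: uweight_gt0|exact: ltW|].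
  rewrite radius_uweight; apply: hs; split=> [l|].
    by rewrite mxE ger0_norm // exprn_ge0 // ltW.
  by rewrite ger0_norm // ltW.
- move=> e x [he hx]; apply/matrixP => i j; rewrite mssumE; apply/esym/ssumE/hs.
  have le1 : 2^-1 * r1 <= r1 by rewrite ler_piMl ?(ltW r10) // invf_le1 ?ler1n.
  have le0 : 0 <= 2^-1 * r1 by rewrite mulr_ge0 ?invr_ge0 // ltW.
  split=> [l|]; last exact: le_trans le1.
  by apply: le_trans (he l) _; rewrite lerXn2r ?nnegrE // ltW.
Qed.

End Expansion.

Lemma prenormal_conj (F : fieldType) (n : nat) (P Q B dP D L q S : 'M[F]_n) (u : F) :
  P *m Q = 1%:M -> B *m P = P *m D -> D = L + u *: q -> S = q - Q *m dP ->
  P *m (L + u *: S) = B *m P - u *: dP.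
Proof.
move=> PQ BP hD ->; rewrite BP hD scalerBr addrA mulmxBr -scalemxAr mulmxA PQ.
by rewrite mul1mx.
Qed.

(** * Choice of radius and assembly of the prenormal form *)

Section Main.
Variables (R : realType) (k n : nat).
Local Notation K := (complex_field R).
Local Notation series := (mindex (k + 1) -> K).

Lemma derive_mssum (A : 'I_n -> 'I_n -> series) (r : K) (e : 'rV[K]_k) (x : K) :
  0 < r -> (forall i j, ssummable (A i j) (radius (@uweight k) r)) ->
  (forall i, `|e ord0 i| <= r ^+ k.+2) -> `|x| < 2^-1 * r ->
  Defs.derive_mx (fun t : K => mssum A (expoint e t)) x =
  mssum (fun i j => sderive (A i j)) (expoint e x).
Proof.
move=> r0 hA he hx.
have hr0 : 0 < 2^-1 * r by rewrite mulr_gt0 // invr_gt0.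
have hrr : 2^-1 * r <= r by rewrite ler_piMl ?(ltW r0) // invf_le1 ?ler1n.
have sA : forall (t : K) i j, `|t| <= r -> ssummable (A i j) (expoint e t).
  move=> t i j ht; apply: ssummable_disc (hA i j).
  by apply: disc_radius; [exact: ltW|split].
have sr i j : ssummable (A i j) (expoint e r) by apply: sA; rewrite gtr0_norm.
apply/matrixP => i j; rewrite [RHS]mssumE [LHS]mxE.
have -> : (fun t => mssum A (expoint e t) i j) = (fun t => ssum (A i j) (expoint e t)).
  by apply/funext => t; exact: mssumE.
have [C hC] := sr i j.
have hf (t : K) : `|t| <= 2^-1 * r ->
    has_sum (terms (A i j) (expoint e t)) (ssum (A i j) (expoint e t)).
  by move=> ht; apply/has_ssum/sA; exact: le_trans ht hrr.
have hC2 : abs_le (terms (A i j) (expoint e (2 * (2^-1 * r)))) C.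
  by rewrite mulVKf // pnatr_eq0.
have hd : ssummable (sderive (A i j)) (expoint e (2^-1 * r)).
  by eexists; apply: abs_le_sderive hC; rewrite gt_eqF.
have hdx : ssummable (sderive (A i j)) (expoint e x).
  apply: ssummable_disc hd; apply: var_cases => [l|]; first by rewrite !point_l.
  by rewrite !point_x (gtr0_norm hr0) ltW.
exact: (has_sum_derive hr0 hx hf hC2 (has_ssum hdx)).
Qed.

(** The witness is the inverse of 1 plus both quantities to be controlled. The two inequalities are
    the smallness conditions of [diagonalize_series] and [weierstrass_division] at radius t r0,
    where the norm of C is at most t G. *)
Lemma small_radius (M G r0 : K) : 0 <= M -> 0 <= G -> 0 < r0 -> r0 <= 1 ->
  exists t : K, [/\ 0 < t, t <= 1, 6 * n%:R * M * (t * G) <= 1 &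
    k%:R * (t * r0) <= 2^-1].
Proof.
move=> M0 G0 r00 r01.
pose s : K := 1 + 6 * n%:R * M * G + 2 * k%:R.
have a0 : 0 <= 6 * n%:R * M * G by rewrite !mulr_ge0.
have b0 : 0 <= 2 * k%:R :> K by rewrite mulr_ge0.
have s0 : 0 < s by rewrite ltr_wpDr // ltr_wpDr.
exists s^-1; split.
- by rewrite invr_gt0.
- by rewrite invf_le1 // /s -addrA lerDl addr_ge0.
- rewrite (_ : _ * _ = (6 * n%:R * M * G) / s); last by ring.
  by rewrite ler_pdivrMr // mul1r /s addrAC lerDr addr_ge0.
- rewrite (_ : _ * _ = (k%:R * r0) / s); last by ring.
  rewrite ler_pdivrMr // ler_pdivlMl //.
  apply: (@le_trans _ _ (2 * k%:R)); last by rewrite /s lerDr addr_ge0.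
  by rewrite ler_wpM2l // ler_piMr.
Qed.

(** A sum of bounds replaces their maximum. *)
Lemma common_bound (A : 'I_n -> 'I_n -> series) z :
  (forall i j, ssummable (A i j) z) ->
  exists2 G : K, 0 <= G & forall i j, abs_le (terms (A i j) z) G.
Proof.
move=> hA; pose c i j : K := sval (cid (hA i j)).
have hc i j : abs_le (terms (A i j) z) (c i j) by exact: (svalP (cid (hA i j))).
have c0 i j : 0 <= c i j by exact: abs_le_ge0 (hc i j).
exists (\sum_i \sum_j c i j).
  by apply: sumr_ge0 => i _; apply: sumr_ge0.
move=> i j; apply: abs_leW (hc i j).
rewrite (bigD1 i) //= (bigD1 j) //= -addrA lerDl addr_ge0 ?sumr_ge0 // => l _.
exact: sumr_ge0.
Qed.

End Main.

Theorem theorem3p4 (R : realType) (k n : nat)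
    (B : 'rV[complex_field R]_k -> complex_field R -> 'M[complex_field R]_n) :
  (1 <= k)%N -> (1 <= n)%N ->
  analytic_mx B ->
  is_diag_mx (B 0 0) ->
  distinct_eigenvalues (B 0 0) ->
  exists (lam : 'I_n -> 'I_k.+1 -> 'rV[complex_field R]_k -> complex_field R)
         (S : 'rV[complex_field R]_k -> complex_field R -> 'M[complex_field R]_n),
    (forall i q, analytic_at0 (lam i q)) /\
    analytic_mx S /\
    analytically_equivalent (@unfolding (complex_field R) k) B
      (prenormal_mx lam S).
Proof.
move=> _ n0 /analytic_mx_expansion[A [r0 [r00 r01 hA BA]]] dB eB.
set K := complex_field R in A r0 r00 r01 hA BA *.
pose b i := B 0 0 i i.
have binj : injective b := distinct_eigenvalues_diag dB eB.
have A0 i j : A i j mzero = B 0 0 i j.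
  have d0 : disc r0 (0 : 'rV[K]_k) (0 : K).
    by split=> [l|]; rewrite ?mxE normr0 ?exprn_ge0 // ltW.
  have p0 : expoint (0 : 'rV[K]_k) (0 : K) = 0.
    by apply/rowP; apply: var_cases => [l|]; rewrite ?point_l ?point_x !mxE.
  rewrite (BA _ _ d0) mssumE p0; apply/esym/has_sum_at0/has_ssum.
  by apply: ssummable_disc (hA i j) => l; rewrite mxE normr0.
(* Expansion of B - B(0,0), which has no constant term. *)
pose C i j : mindex (k + 1) -> K := fun al => A i j al - B 0 0 i j * smono K mzero al.
have C0 i j : C i j mzero = 0 by rewrite /C A0 /smono eqxx mulr1 subrr.
have sC i j : ssummable (C i j) (radius (@uweight k) r0).
  by apply: ssummableD => //; apply: ssummableN; apply: ssummableZ; exact: ssummable_mono.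
have [G G0 hG] := common_bound sC.
(* The diagonal terms are 0, being inverses of 0. *)
pose M : K := \sum_i \sum_j `|(b i - b j)^-1|.
have M0 : 0 <= M by apply: sumr_ge0 => i _; exact: sumr_ge0.
have hM i j : i != j -> `|(b i - b j)^-1| <= M.
  move=> _; rewrite /M (bigD1 i) //= (bigD1 j) //= -addrA lerDl.
  by rewrite addr_ge0 ?sumr_ge0 // => l _; exact: sumr_ge0.
have [t [t0 t1 small kr]] := small_radius k n M0 G0 r00 r01.
pose r := t * r0.
have rp : 0 < r by rewrite mulr_gt0.
have r1 : r <= 1 by rewrite mulr_ile1 // ltW.
pose z0 := radius (@uweight k) r.
have hC i j : abs_le (terms (C i j) z0) (t * G).
  by apply: (abs_le_vanish (@uweight_gt0 k)) => //; exact: ltW.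
have tG : 0 <= t * G by rewrite mulr_ge0 // ltW.
have [X [XE X0 hX]] := diagonalize_series (@uweight_gt0 k) n0 M0 tG hM C0 hC small.
have [Q [sQ PQ]] := inverse_series (@uweight_gt0 k) n0 X0 hX.
have sX i j : ssummable (X i j) z0 by eexists; exact: hX.
have sC0 i j : ssummable (C i j) z0 by eexists; exact: hC.
(* Diagonal of D as determined by X; these are the series to be divided by p. *)
pose D j : mindex (k + 1) -> K :=
  fun al => b j * smono K mzero al + C j j al + mmul C X j j al.
have sD j : ssummable (D j) z0.
  apply: ssummableD; last exact: ssummable_mmul.
  by apply: ssummableD => //; apply: ssummableZ; exact: ssummable_mono.
have /choice[ql hql] : forall j,
    exists ql : (mindex (k + 1) -> K) * ('I_k.+1 -> mindex k -> K),
    [/\ ssummable ql.1 z0, forall i, ssummable (ql.2 i) (const_mx (r ^+ k.+2)) &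
        forall e x, disc r e x ->
          ssum (D j) (expoint e x) = \sum_(i < k.+1) ssum (ql.2 i) e * x ^+ i +
            unfolding e x * ssum ql.1 (expoint e x)].
  move=> j; have [q [lam h]] := weierstrass_division rp r1 kr (sD j).
  by exists (q, lam).
pose P i j : mindex (k + 1) -> K := fun al => mone R i j al + X i j al.
have sP i j : ssummable (P i j) z0 by apply: ssummableD => //; exact: ssummable_mone.
pose dP i j := sderive (P i j).
pose S i j : mindex (k + 1) -> K :=
  fun al => (i == j)%:R * (ql j).1 al - mmul Q dP i j al.
have rk : 0 < r ^+ k.+2 by rewrite exprn_gt0.
have hr : 0 < 2^-1 * r by rewrite mulr_gt0 // invr_gt0.
(* The e-radii of [z0] with half its x-radius: the derivative of P is known to be summable there. *)
pose z1 := expoint (const_mx (r ^+ k.+2) : 'rV[K]_k) (2^-1 * r).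
have z1z0 i : `|z1 ord0 i| <= `|z0 ord0 i|.
  rewrite /z0 radius_uweight; move: i; apply: var_cases => [l|].
    by rewrite !point_l.
  by rewrite !point_x !gtr0_norm // ler_piMl ?(ltW rp) // invf_le1 ?ler1n.
(* A common lower bound for the coordinates of [z1]: the polydisc it spans is a neighbourhood of the
   origin, as analyticity requires. *)
have z1ge i : 2^-1 * r ^+ k.+2 <= `|z1 ord0 i|.
  move: i; apply: var_cases => [l|].
    rewrite point_l mxE gtr0_norm // ler_piMl ?(ltW rk) // invf_le1 ?ler1n //.
  rewrite point_x gtr0_norm // ler_wpM2l ?invr_ge0 //.
  by rewrite exprS ler_piMr ?(ltW rp) // exprn_ile1 // ltW.
have rho0 : 0 < 2^-1 * r ^+ k.+2 by rewrite mulr_gt0 // invr_gt0.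
have sdP i j : ssummable (dP i j) z1.
  have [c hc] := sP i j; rewrite /z0 radius_uweight in hc.
  by eexists; apply: abs_le_sderive hc; rewrite gt_eqF.
have sQ1 i j : ssummable (Q i j) z1 by exact: ssummable_disc z1z0 (sQ i j).
have sS i j : ssummable (S i j) z1.
  apply: ssummableD; last by apply: ssummableN; exact: ssummable_mmul.
  by apply: ssummableZ; apply: ssummable_disc z1z0 _; case: (hql j).
exists (fun i q => ssum ((ql i).2 q)), (fun e x => mssum S (expoint e x)); split.
  move=> i q; have [_ /(_ q) sl _] := hql i.
  by apply: (analytic_ssum rk _ sl) => l; rewrite mxE gtr0_norm.
split; first exact: analytic_mssum rho0 z1ge sS.
exists (fun e x => mssum P (expoint e x)).
have zz0 e x : disc r e x -> forall i, `|expoint e x ord0 i| <= `|z0 ord0 i|.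
  by apply: disc_radius; exact: ltW.
have PX e x : disc r e x -> mssum P (expoint e x) = 1%:M + mssum X (expoint e x).
  move=> hd; apply/matrixP => i j; rewrite mssumE [RHS]mxE mssumE mxE.
  rewrite ssumD ?ssum_mone //; first exact: ssummable_mone.
  exact: ssummable_disc (zz0 _ _ hd) (sX i j).
have near_P := near_disc_point k rp.
have half e x : (forall i, `|(e : 'rV[K]_k) ord0 i| <= r ^+ k.+2) /\ `|x| < 2^-1 * r ->
    disc r e x.
  move=> [he hx]; split=> //; apply: le_trans (ltW hx) _.
  by rewrite ler_piMl ?(ltW rp) // invf_le1 ?ler1n.
split; last first.
  apply: filterS near_P => -[e x] /= hex; have hd := half _ _ hex.
  have [he hx] := hex; have zz := zz0 _ _ hd.
  have zz1 i : `|expoint e x ord0 i| <= `|z1 ord0 i|.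
    move: i; apply: var_cases => [l|].
      by rewrite !point_l mxE (gtr0_norm rk).
    by rewrite !point_x (gtr0_norm hr) ltW.
  rewrite (derive_mssum rp sP he hx) -/dP.
  have sXz i j : ssummable (X i j) (expoint e x) by exact: ssummable_disc zz (sX i j).
  have sCz i j : ssummable (C i j) (expoint e x) by exact: ssummable_disc zz (sC0 i j).
  have sQz i j : ssummable (Q i j) (expoint e x) by exact: ssummable_disc zz (sQ i j).
  have sdPz i j : ssummable (dP i j) (expoint e x) by exact: ssummable_disc zz1 (sdP i j).
  have sqz j : ssummable (ql j).1 (expoint e x).
    by apply: ssummable_disc zz _; case: (hql j).
  (* The expansion of B holds on the disc of the initial radius [r0], which contains the present
     one. *)
  have hd0 : disc r0 e x.
    have rr0 : r <= r0 by rewrite ler_piMl // ltW.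
    case: hd => h1 h2; split=> [l|]; last exact: le_trans rr0.
    by apply: le_trans (h1 l) _; rewrite lerXn2r ?nnegrE // ltW.
  pose dq := diag_mx (\row_j ssum (ql j).1 (expoint e x)).
  pose DD := diag_mx (\row_j (b j + ssum (C j j) (expoint e x) +
     ssum (mmul C X j j) (expoint e x))).
  apply: (@prenormal_conj _ _ _ (mssum Q (expoint e x)) _ _ DD _ dq).
  - by rewrite PX //; exact: PQ.
  - rewrite PX //; have := mssum_diagonalize binj XE sCz sXz.
    (* As B(0,0) is diagonal, removing it from B and adding diag(b) back changes nothing. *)
    suff -> : diag_mx (\row_i b i) + mssum C (expoint e x) = B e x by [].
    rewrite (BA _ _ hd0); apply/matrixP => i j; rewrite mxE !mssumE !mxE.
    have sAz : ssummable (A i j) (expoint e x).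
      by apply: ssummable_disc (hA i j); apply: disc_radius => //; exact: ltW.
    rewrite ssumD //; last by apply: ssummableN; apply: ssummableZ; exact: ssummable_mono.
    rewrite ssumN; last by apply: ssummableZ; exact: ssummable_mono.
    rewrite ssumZ ?ssum_mono ?monomial_zero ?mulr1; last exact: ssummable_mono.
    have [<-|ij] := eqVneq i j; first by rewrite mulr1n addrC subrK.
    by rewrite mulr0n (is_diag_mxP dB) // subr0 add0r.
  - apply/matrixP => i j; rewrite !mxE; have [_|_] := eqVneq i j; last first.
      by rewrite !mulr0n mulr0 addr0.
    rewrite !mulr1n; case: (hql i) => _ _ /(_ _ _ hd) <-.
    have s1 := ssummableZ (b i) (ssummable_mono mzero (expoint e x)).
    have s2 := ssummableD s1 (sCz i i).
    rewrite (ssumD s2 (ssummable_mmul sCz sXz i i)) (ssumD s1 (sCz i i)).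
    by rewrite ssumZ ?ssum_mono ?monomial_zero ?mulr1 //; exact: ssummable_mono.
  - rewrite -(mssumM sQz sdPz); apply/matrixP => i j.
    rewrite mssumE [RHS]mxE [X in _ = _ + X]mxE mssumE mxE mxE.
    have sM := ssummable_mmul sQz sdPz i j.
    rewrite ssumD ?ssumN ?ssumZ //; last 2 first.
    + exact: ssummableZ.
    + exact: ssummableN.
    by have [<-|ij] := eqVneq i j; rewrite ?mul1r ?mul0r.
split.
  apply: analytic_mssum rho0 z1ge _ => i j.
  exact: ssummable_disc z1z0 (sP i j).
exists (fun e x => mssum Q (expoint e x)); split.
  exact: analytic_mssum rho0 z1ge sQ1.
apply: filterS near_P => -[e x] /= /half hd.
have h : mssum P (expoint e x) *m mssum Q (expoint e x) = 1%:M.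
  by rewrite PX //; apply: PQ; exact: zz0.
(* For square matrices the right inverse is two-sided. *)
by split; [exact: h|exact: mulmx1C h].
Qed.
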